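(* For every $\epsilon>0$ there exist an $\exists$-$\emptyset$-formula $\varphi(x)$ and a set $P$ of prime numbers of Dirichlet density at least $1-\epsilon$ such that for every henselian valued field $K$ with valuation ring $\mathcal{O}$ and residue field $F$ with $|F|\in P$, the formula $\varphi$ defines $\mathcal{O}$ in $K$, i.e. $\varphi(K)=\mathcal{O}$.
   Context: $\mathcal{L}=\{+,-,\cdot,0,1\}$ is the language of rings. An $\exists$-$\emptyset$-formula is an existential $\mathcal{L}$-formula without parameters. For a formula $\varphi(x)$ in one free variable, $\varphi(K)$ denotes the subset of $K$ that it defines. *)

(* Defs.v *)
From HB Require Import structures.
From mathcomp Require Import all_boot all_order all_algebra.
From mathcomp Require Import generic_quotient ring_quotient.
From mathcomp Require Import all_classical all_reals all_analysis.

Set Implicit Arguments.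
Unset Strict Implicit.
Unset Printing Implicit Defensive.

Import Order.TTheory GRing.Theory Num.Theory.
Import numFieldNormedType.Exports.

Local Open Scope classical_set_scope.
Local Open Scope ring_scope.
Local Open Scope quotient_scope.

(* [rterm n] and [qf_formula n] have their variables among v_0, ..., v_(n-1).
   [GRing.formula R] is not used because it has constants for all elements of
   R, hence depends on the ring in which the formula is interpreted. *)
Inductive rterm (n : nat) : Type :=
| TVar of 'I_n
| TZero
| TOne
| TAdd of rterm n & rterm n
| TSub of rterm n & rterm n
| TMul of rterm n & rterm n.

Inductive qf_formula (n : nat) : Type :=
| FEq of rterm n & rterm n
| FNot of qf_formula n
| FAnd of qf_formula n & qf_formula n
| FOr of qf_formula n & qf_formula n.

(* [EFormula m psi] is the formula
   exists v_1 ... v_m, psi (v_0, v_1, ..., v_m), with v_0 free. *)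
Record eformula : Type := EFormula {
  ef_bound : nat;
  ef_matrix : qf_formula ef_bound.+1
}.

Section Semantics.
Variable K : nzRingType.

Fixpoint eval_term n (v : 'I_n -> K) (t : rterm n) : K :=
  match t with
  | TVar i => v i
  | TZero => 0
  | TOne => 1
  | TAdd t1 t2 => eval_term v t1 + eval_term v t2
  | TSub t1 t2 => eval_term v t1 - eval_term v t2
  | TMul t1 t2 => eval_term v t1 * eval_term v t2
  end.

Fixpoint holds_qf n (v : 'I_n -> K) (psi : qf_formula n) : Prop :=
  match psi with
  | FEq t1 t2 => eval_term v t1 = eval_term v t2
  | FNot psi1 => ~ holds_qf v psi1
  | FAnd psi1 psi2 => holds_qf v psi1 /\ holds_qf v psi2
  | FOr psi1 psi2 => holds_qf v psi1 \/ holds_qf v psi2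
  end.

Definition env_cons m (x : K) (y : 'I_m -> K) : 'I_m.+1 -> K :=
  fun i => if unlift ord0 i is Some j then y j else x.

Definition defined_set (phi : eformula) : set K :=
  [set x | exists y : 'I_(ef_bound phi) -> K,
             holds_qf (env_cons x y) (ef_matrix phi)].

End Semantics.

(* A valued field is a pair (K, O) of a field and a valuation ring of K, which
   is the same as a valuation on K up to equivalence. The trivial case O = K is
   allowed. *)
Record valuationRing (K : fieldType) : Type := ValuationRing {
  vr_pred :> {pred K};
  vr_subring : subring_closed vr_pred;
  vr_total : forall x : K, x != 0 -> x \in vr_pred \/ x^-1 \in vr_pred
}.

Section ResidueField.
Variables (K : fieldType) (O : valuationRing K).

HB.instance Definition _ :=
  GRing.isSubringClosed.Build K (vr_pred O) (vr_subring O).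

Definition vring : Type := {x : K | x \in vr_pred O}.
HB.instance Definition _ := SubChoice.on vring.
HB.instance Definition _ := [SubChoice_isSubComNzRing of vring by <:].

(* In a valuation ring, the maximal ideal is the set of nonunits. *)
Definition max_ideal : {pred vring} :=
  fun a => `[< ~ exists b : vring, a * b = 1 >].

Lemma max_idealPn (a : vring) :
  reflect (exists b : vring, a * b = 1) (a \notin max_ideal).
Proof.
apply: (iffP negP) => [h|h /asboolP //].
by apply: contrapT => h'; apply/h/asboolP.
Qed.

Lemma val_inv_unit (a : vring) :
  a != 0 -> (val a)^-1 \in vr_pred O -> exists b : vring, a * b = 1.
Proof.
move=> a0 h; exists (exist _ (val a)^-1 h : vring); apply: val_inj.
by rewrite rmorphM rmorph1 /= mulfV // (inj_eq val_inj a 0).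
Qed.

Lemma max_ideal_closed : idealr_closed max_ideal.
Proof.
have M (a b : vring) : b \in max_ideal -> a * b \in max_ideal.
  apply: contraLR => /max_idealPn[c abc]; apply/max_idealPn.
  by exists (a * c); rewrite mulrA (mulrC b).
split.
- apply/asboolP => -[b /eqP]; by rewrite mul0r eq_sym oner_eq0.
- by apply/max_idealPn; exists 1; rewrite mulr1.
move=> a u' v /(M a); move: (a * u') => u uI vI.
have [->|u0] := eqVneq u 0; first by rewrite add0r.
have [->|v0] := eqVneq v 0; first by rewrite addr0.
wlog uv : u v uI vI u0 v0 / val v / val u \in vr_pred O.
  have vu0 : val v / val u != 0.
    by rewrite mulf_neq0 ?invr_eq0 // (inj_eq val_inj _ 0).
  move=> H; have [uv|] := vr_total O vu0; first exact: H.
  by rewrite invf_div addrC; apply: H.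
have -> : u + v = (1 + (exist _ (val v / val u) uv : vring)) * u.
  apply: val_inj; rewrite rmorphM !rmorphD rmorph1 /= mulrDl mul1r.
  by rewrite divfK // (inj_eq val_inj _ 0).
exact: M.
Qed.

HB.instance Definition _ := isIdealr.Build vring max_ideal max_ideal_closed.

Definition residue_field := {ideal_quot max_ideal}.
HB.instance Definition _ := GRing.ComNzRing.on residue_field.

Definition residue : vring -> residue_field := \pi_({ideal_quot max_ideal}).

Lemma residue_field_inv (x : residue_field) : x != 0 -> exists y, x * y = 1.
Proof.
elim/quotW: x => a a0; have /max_idealPn[b ab] : a \notin max_ideal.
  apply: contra a0 => aI; apply/eqP; rewrite -(rmorph0 \pi_residue_field).
  by apply/eqP; rewrite -Quotient.idealrBE subr0.
by exists (\pi b); rewrite -rmorphM ab rmorph1.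
Qed.

(* Simple zeros of the reduction of f lift to zeros of f. *)
Definition henselian : Prop :=
  forall (f : {poly vring}) (a : residue_field),
    root (map_poly residue f) a -> ~~ root (map_poly residue f)^`() a ->
    exists2 b : vring, root f b & residue b = a.

End ResidueField.

(* For P a set of primes and s > 1, the sum is finite, so that [fine] only
   projects it to R. *)
Definition prime_zeta (R : realType) (P : set nat) (s : R) : R :=
  fine (\esum_(p in P) (p%:R `^ (- s))%:E).

Definition has_dirichlet_density (R : realType) (P : set nat) (d : R) : Prop :=
  prime_zeta P s / prime_zeta [set p | prime p] s @[s --> 1^'+] --> d.

(* Main.v *)
From HB Require Import structures.
Require Import Defs.
From mathcomp Require Import all_boot all_order all_algebra all_field.
From mathcomp Require Import cyclic generic_quotient ring_quotient.
From mathcomp Require Import all_classical all_reals all_analysis.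
From mathcomp Require Import complex ring lra zify.

(* Fix an odd prime q with 1 / (q - 1) <= eps, let f = 1 + X + ... + X^(q-1), and
   let P be the set of primes p > q with p <> 1 mod q.  For p in P the polynomial
   f has no zero mod p, hence 1 / f(y) lies in the valuation ring for every y in K:
   it is the inverse of a unit if y is integral, and otherwise f palindromic gives
   1 / f(y) = y^(1-q) / f(y^-1).  The set A = 1 / f(F_p) has at least p / (q - 1)
   elements, so sums of 2 (q - 1) differences of elements of A fill F_p; adding one
   more term 1 / f(y_0) with y_0 reducing to the simple zero 0 of f - 1, Hensel's
   lemma turns this covering of the residue field into one of the valuation ring.

   For the density, Mertens' method shows that for a nontrivial character chi mod q
   the sum of chi(p) ln p / p over p <= N is O(1) if L(1, chi) <> 0 and
   - ln N + O(1) if L(1, chi) = 0.  Summing over all chi, (q - 1) times the sum of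
   ln p / p over p = 1 mod q is (1 - z) ln N + O(1), where z is the number of
   vanishing L(1, chi).  As this is nonnegative, z <= 1, so the primes = 1 mod q have
   density 1 / (q - 1) or 0, and either value suffices: the nonvanishing of L(1, chi)
   is never needed.  Summation by parts with the weights n^(1-s) / ln n passes from
   these sums to the Dirichlet density. *)

Set Implicit Arguments.
Unset Strict Implicit.
Unset Printing Implicit Defensive.

Import Order.TTheory GRing.Theory Num.Theory.
Import numFieldNormedType.Exports.
Local Open Scope ring_scope.

(** * Divisor sums and the Moebius function *)

(** Induction on [N]: the quotient [N %/ d] grows by one exactly when [d] divides [N.+1]. *)
Lemma sum_multiples (V : nmodType) (G : nat -> V) d N : (0 < d)%N ->
  \sum_(1 <= n < N.+1 | (d %| n)%N) G (n %/ d)%N =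
  \sum_(1 <= m < (N %/ d).+1) G m.
Proof.
move=> d0; elim: N => [|N IH]; first by rewrite div0n !big_geq.
rewrite big_mkcond big_nat_recr //= -big_mkcond IH divnS //.
case: ifP => dN; last by rewrite addr0.
by rewrite [in RHS]big_nat_recr //= dN.
Qed.

(** Both sides run over the pairs [(d, m)] of positive integers with [d * m <= N]. *)
Lemma sum_divisor_pairs (V : nmodType) (F : nat -> nat -> V) N :
  \sum_(1 <= n < N.+1) \sum_(1 <= d < n.+1 | (d %| n)%N) F d (n %/ d)%N =
  \sum_(1 <= d < N.+1) \sum_(1 <= m < (N %/ d).+1) F d m.
Proof.
transitivity (\sum_(1 <= n < N.+1) \sum_(1 <= d < N.+1 | (d %| n)%N)
    F d (n %/ d)%N).
  apply: eq_big_nat => n /andP[n0 nN].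
  rewrite [RHS](@big_cat_nat _ _ _ n.+1) //= [X in _ + X]big1_seq ?addr0 //.
  move=> d /andP[dn]; rewrite mem_index_iota => /andP[nd _].
  by have := dvdn_leq n0 dn; rewrite leqNgt nd.
rewrite (exchange_big_dep xpredT) //= big_nat [RHS]big_nat.
by apply: eq_bigr => d /andP[d0 _]; exact: sum_multiples.
Qed.

(** Strips the least prime factor at each call; [fuel] serves termination only, and any fuel at
    least [n] gives the same value. At 0 the value is the default 1. *)
Fixpoint mobius_rec fuel n : int :=
  if fuel is k.+1 then
    if (n <= 1)%N then 1 else
    let e := (n %/ pdiv n)%N in
    if (pdiv n %| e)%N then 0 else - mobius_rec k e
  else 1.

Definition mobius n : int := mobius_rec n n.

Lemma mobius_recE k n : (n <= k)%N -> mobius_rec k n = mobius n.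
Proof.
rewrite /mobius; elim/ltn_ind: n k => -[_ [|k]//|n IH [|k]//].
rewrite ltnS => nk /=; case: ifP => // /negbT; rewrite -ltnNge => n1.
have ltd : (n.+1 %/ pdiv n.+1 < n.+1)%N.
  by rewrite ltn_Pdiv // prime_gt1 // pdiv_prime.
by case: ifP => // _; rewrite IH ?(leq_trans _ nk)// [in RHS]IH.
Qed.

Lemma mobiusM p e : prime p -> (0 < e)%N -> pdiv (p * e) = p ->
  mobius (p * e) = if (p %| e)%N then 0 else - mobius e.
Proof.
move=> pp e0 pde; have p1 := prime_gt1 pp.
have lt1 : (1 < p * e)%N by nia.
rewrite {1}/mobius; case E: (p * e)%N lt1 pde => [|k] // lt1 pde.
rewrite /= leqNgt lt1 /= pde -E mulKn ?prime_gt0 //.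
case: ifP => // _; rewrite mobius_recE //.
by nia.
Qed.

Lemma mobius1 : mobius 1 = 1. Proof. by []. Qed.

Lemma norm_mobius n : `|mobius n| <= 1.
Proof.
suff H k : `|mobius_rec k n| <= 1 by exact: H.
elim: k n => [|k IH] n //=; case: ifP => // _; case: ifP => // _.
by rewrite normrN.
Qed.

Lemma sum_divisorsM (V : nmodType) (G : nat -> V) p e : (0 < p)%N -> (0 < e)%N ->
  \sum_(1 <= d < (p * e).+1 | (d %| p * e)%N && (p %| d)%N) G d =
  \sum_(1 <= d < e.+1 | (d %| e)%N) G (p * d)%N.
Proof.
move=> p0 e0.
transitivity (\sum_(1 <= d < (p * e).+1 | (p %| d)%N)
    (if (d %/ p %| e)%N then G (p * (d %/ p))%N else 0)).
  rewrite big_mkcondl; apply: eq_bigr => d pd; rewrite -{1 2}(divnK pd).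
  by rewrite (mulnC _ p) dvdn_pmul2l.
rewrite (sum_multiples (fun d => if (d %| e)%N then G (p * d)%N else 0)) //.
by rewrite mulKn // -big_mkcond.
Qed.

(* Among the divisors of [n], [d] prime to [pdiv n] cancels against [pdiv n * d],
   and the multiples of [(pdiv n)^2] contribute [0]. *)
Lemma sum_mobius n : (0 < n)%N ->
  \sum_(1 <= d < n.+1 | (d %| n)%N) mobius d = (n == 1)%:R.
Proof.
rewrite leq_eqVlt => /predU1P[<-|n1].
  by rewrite big_mkcond big_nat1 dvdnn mobius1.
have n0 := ltnW n1.
rewrite gtn_eqF //; set p := pdiv n; have pp : prime p by exact: pdiv_prime.
rewrite (bigID (fun d => p %| d)%N) /=.
have [e En] := dvdnP (pdiv_dvd n); rewrite -/p mulnC in En.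
have e0 : (0 < e)%N by move: n0; rewrite En muln_gt0 => /andP[].
rewrite {1 2}En sum_divisorsM ?(prime_gt0 pp) //.
rewrite (_ : \sum_(1 <= d < n.+1 | (d %| n)%N && ~~ (p %| d)%N) mobius d =
    \sum_(1 <= d < e.+1 | (d %| e)%N && ~~ (p %| d)%N) mobius d); last first.
  rewrite [RHS](@big_nat_widen _ _ _ _ _ n.+1); last by rewrite ltnS En leq_pmull ?prime_gt0.
  rewrite big_mkcond [RHS]big_mkcond; apply: eq_big_nat => d /andP[d0 _].
  case: (boolP (p %| d)%N) => pd /=; rewrite ?(andbF, andFb) // ?andbT.
  have cop : coprime d p by rewrite coprime_sym prime_coprime.
  rewrite En Gauss_dvdr // ltnS; case: (boolP (d %| e)%N) => de //=.
  by rewrite (dvdn_leq e0 de).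
rewrite big_mkcondr /= -big_split /= big_nat_cond big1 //= => d.
move=> /andP[/andP[d0 dN] de].
rewrite mobiusM //; first by case: ifP => //= _; rewrite ?addr0 // addNr.
have dn : (p * d %| n)%N by rewrite En dvdn_pmul2l ?prime_gt0.
apply/eqP; rewrite eqn_leq; apply/andP; split.
  by rewrite pdiv_min_dvd ?prime_gt1 ?dvdn_mulr.
rewrite pdiv_min_dvd //; first by rewrite prime_gt1 // pdiv_prime //; have := prime_gt1 pp; nia.
exact: dvdn_trans (pdiv_dvd _) dn.
Qed.

(** * Von Mangoldt and Chebyshev functions *)

Lemma sum_nat_delta (V : nmodType) (P : pred nat) (F : nat -> V) a N :
  \sum_(1 <= n < N.+1 | P n && (a == n)) F n =
  if [&& (0 < a)%N, (a <= N)%N & P a] then F a else 0.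
Proof.
rewrite big_mkcond /=; case: ifPn => [/and3P[a0 aN Pa]|aP].
  rewrite (bigD1_seq a) ?iota_uniq ?mem_index_iota ?a0 //= Pa eqxx /=.
  by rewrite big1 ?addr0 // => i /negbTE; rewrite eq_sym => ->; rewrite andbF.
apply: big1_seq => i /andP[_]; rewrite mem_index_iota ltnS => /andP[i0 iN].
by case: ifP => // /andP[Pi /eqP ai]; move: aP; rewrite ai i0 iN Pi.
Qed.

Section VonMangoldt.
Variable R : realType.
Local Notation ln n := (@exp.ln R n%:R).

Lemma ln_nat_ge0 n : 0 <= ln n.
Proof. by case: n => [|n]; [rewrite exp.ln0|rewrite ln_ge0 // ler1n]. Qed.

Lemma ln_natM m n : (0 < m)%N -> (0 < n)%N -> ln (m * n)%N = ln m + ln n.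
Proof. by move=> m0 n0; rewrite natrM lnM // posrE ltr0n. Qed.

Lemma ln_natX m k : (0 < m)%N -> ln (m ^ k)%N = k%:R * ln m.
Proof. by move=> m0; rewrite natrX lnXn ?ltr0n // mulr_natl. Qed.

Lemma ler_ln_nat m n : (m <= n)%N -> ln m <= ln n.
Proof.
case: m => [|m] mn; first by rewrite exp.ln0 // ln_nat_ge0.
by rewrite ler_ln ?posrE ?ltr0n ?ler_nat // (leq_trans _ mn).
Qed.

Lemma ln_nat_succ n : (0 < n)%N -> ln n.+1 - ln n <= n%:R^-1.
Proof.
move=> n0; have n0' : 0 < n%:R :> R by rewrite ltr0n.
rewrite -ln_div ?posrE ?ltr0n // -natr1 mulrDl divff ?gt_eqF // mul1r.
by rewrite le_ln1Dx // (lt_trans (ltrN10 _)) // invr_gt0.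
Qed.

(** At most one pair [(p, k)] occurs, by unique factorization; the double sum, rather than a case
    distinction, can be exchanged with other sums. *)
Definition vonM (n : nat) : R :=
  \sum_(1 <= p < n.+1 | prime p) \sum_(1 <= k < n.+1 | (p ^ k == n)%N) ln p.

Lemma vonM_ge0 n : 0 <= vonM n.
Proof. by apply: sumr_ge0 => p _; apply: sumr_ge0 => k _; exact: ln_nat_ge0. Qed.

(** If [p ^ k = n] with [k > 0] then [p <= n] and [k < n], so the added terms vanish. A range common
    to all [n <= N] is what exchanging sums requires. *)
Lemma vonM_widen n N : (0 < n <= N)%N -> vonM n =
  \sum_(1 <= p < N.+1 | prime p) \sum_(1 <= k < N.+1 | (p ^ k == n)%N) ln p.
Proof.
move=> /andP[n0 nN]; rewrite /vonM [RHS](@big_cat_nat _ _ _ n.+1) //=.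
rewrite [X in _ = _ + X]big1_seq ?addr0; last first.
  move=> p /andP[pp]; rewrite mem_index_iota => /andP[np _].
  rewrite big_nat_cond big1 // => k /andP[/andP[k0 _] /eqP pk].
  by move: np; rewrite -pk -{2}(expn1 p) ltn_exp2l ?prime_gt1 // ltnNge k0.
apply: eq_bigr => p pp.
rewrite [RHS](@big_cat_nat _ _ _ n.+1) //= [X in _ = _ + X]big1_seq ?addr0 //.
move=> k /andP[/eqP pk]; rewrite mem_index_iota => /andP[nk _].
by have := ltn_expl k (prime_gt1 pp); rewrite pk; lia.
Qed.

Lemma vonM_prime q : prime q -> vonM q = ln q.
Proof.
move=> qp; have q0 := prime_gt0 qp.
transitivity (\sum_(1 <= p < q.+1 | prime p && (q == p)) ln p); last first.
  by rewrite sum_nat_delta q0 leqnn qp.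
rewrite big_mkcondr; apply: eq_bigr => p pp.
have powE k : (0 < k)%N -> (p ^ k == q)%N = (q == p) && (1 == k)%N.
  move=> k0; apply/eqP/andP => [pk|[/eqP-> /eqP<-]]; last by rewrite expn1.
  have qp' : q = p.
    by apply/esym/eqP; rewrite -dvdn_prime2 // -pk dvdn_exp.
  split; first exact/eqP.
  by rewrite -(eqn_exp2l _ _ (prime_gt1 pp)) pk -qp' expn1.
transitivity (\sum_(1 <= k < q.+1 | (q == p) && (1 == k)%N) ln p).
  rewrite big_nat_cond [RHS]big_nat_cond; apply: eq_bigl => k.
  by case: (boolP (1 <= k < q.+1)%N) => //= /andP[k0 _]; exact: powE.
by rewrite sum_nat_delta q0 /=; case: ifP.
Qed.

Lemma ln_nat_factor n : (0 < n)%N ->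
  ln n = \sum_(1 <= p < n.+1 | prime p) (logn p n)%:R * ln p.
Proof.
move=> n0; rewrite -{1}(partnT n0) /partn big_ltn //= lognE /= expn0 mul1n.
rewrite [RHS]big_mkcond.
(* Positivity of the partial products is carried along, since [ln_natM] asks for it. *)
suff [] : (0 < \prod_(1 <= p < n.+1) p ^ logn p n)%N /\
  ln (\prod_(1 <= p < n.+1) p ^ logn p n)%N =
  \sum_(1 <= p < n.+1) (if prime p then (logn p n)%:R * ln p else 0) by [].
rewrite [X in (0 < X)%N]big_nat [X in ln X]big_nat [X in _ = X]big_nat.
apply: (big_rec2 (fun x y => (0 < x)%N /\ ln x = y)) => [|p y x /andP[p0 _] [x0 <-]].
  by rewrite ln1.
split; first by rewrite muln_gt0 expn_gt0 p0.
rewrite ln_natM ?expn_gt0 ?p0 // ln_natX //.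
by case: ifP => // pp; rewrite lognE pp mul0r.
Qed.

(** For each prime [p], the powers [p ^ k] with [k > 0] dividing [n] are those with
    [k <= logn p n]. *)
Lemma sum_divisors_vonM n : (0 < n)%N ->
  \sum_(1 <= d < n.+1 | (d %| n)%N) vonM d = ln n.
Proof.
move=> n0; rewrite ln_nat_factor //.
transitivity (\sum_(1 <= d < n.+1 | (d %| n)%N) \sum_(1 <= p < n.+1 | prime p)
   \sum_(1 <= k < n.+1 | (p ^ k == d)%N) ln p).
  rewrite big_nat_cond [RHS]big_nat_cond; apply: eq_bigr => d /andP[d0 _].
  exact: vonM_widen.
rewrite (exchange_big_dep prime) //=; apply: eq_bigr => p pp.
rewrite (exchange_big_dep xpredT) //=.
transitivity (\sum_(1 <= k < n.+1 | (k <= logn p n)%N) ln p).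
  rewrite [RHS]big_mkcond; apply: eq_bigr => k _.
  rewrite sum_nat_delta expn_gt0 prime_gt0 //= -pfactor_dvdn //.
  case: (boolP (p ^ k %| n)%N) => kl; rewrite ?andbF // ?andbT.
  by rewrite dvdn_leq //= pp.
transitivity (\sum_(1 <= k < (logn p n).+1) ln p); last first.
  by rewrite sumr_const_nat subn1 mulr_natl.
rewrite [RHS](big_nat_widen _ _ n.+1) // ltnS.
have := ltn_expl (logn p n) (prime_gt1 pp).
by move/ltnW/leq_trans; apply; rewrite dvdn_leq // pfactor_dvdnn.
Qed.

(** Legendre's formula for [N!] in logarithmic form: [d] has [N %/ d] multiples up to [N]. *)
Lemma sum_ln_vonM N :
  \sum_(1 <= n < N.+1) ln n = \sum_(1 <= d < N.+1) vonM d * (N %/ d)%:R.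
Proof.
transitivity (\sum_(1 <= n < N.+1) \sum_(1 <= d < n.+1 | (d %| n)%N) vonM d).
  by apply: eq_big_nat => n /andP[n0 _]; rewrite sum_divisors_vonM.
rewrite (sum_divisor_pairs (fun d _ => vonM d)).
by apply: eq_bigr => d _; rewrite sumr_const_nat subn1 mulr_natr.
Qed.

Lemma sum_ln_fact N : \sum_(1 <= n < N.+1) ln n = ln N`!.
Proof.
elim: N => [|N IH]; first by rewrite big_geq // fact0 ln1.
by rewrite big_nat_recr //= IH factS ln_natM ?fact_gt0 // addrC.
Qed.

(** A weak Stirling bound; the inductive step reduces to [N * (ln N.+1 - ln N) <= 1]. *)
Lemma sum_ln_ge N : N%:R * ln N - N%:R <= \sum_(1 <= n < N.+1) ln n.
Proof.
elim: N => [|N IH]; first by rewrite big_geq // mul0r subr0.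
rewrite big_nat_recr //=; have [->|N0] := posnP N.
  by rewrite big_geq // ln1; lra.
have H := ln_nat_succ N0; have N0' : 0 < N%:R :> R by rewrite ltr0n.
have : N%:R * (ln N.+1 - ln N) <= 1.
  by rewrite mulrC -ler_pdivlMr // div1r.
by move: IH; rewrite -[in N.+1%:R]natr1; lra.
Qed.

Lemma sum_ln_le N : \sum_(1 <= n < N.+1) ln n <= N%:R * ln N.
Proof.
have -> : N%:R * ln N = \sum_(1 <= n < N.+1) ln N.
  by rewrite sumr_const_nat subn1 mulr_natl.
rewrite big_nat [leRHS]big_nat.
by apply: ler_sum => n /andP[_ nN]; exact: ler_ln_nat.
Qed.

Definition psi N : R := \sum_(1 <= n < N.+1) vonM n.

Lemma psi_mono m n : (m <= n)%N -> psi m <= psi n.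
Proof.
move=> mn; rewrite /psi [leRHS](@big_cat_nat _ _ _ m.+1) //= lerDl.
by apply: sumr_ge0 => i _; exact: vonM_ge0.
Qed.

(* [(2n)! / (n!)^2 <= 4^n], and the coefficient [2n / d - 2 (n / d)] of
   [vonM d] in its logarithm is [1] for [n < d <= 2n] and nonnegative otherwise. *)
Lemma psi_double n : psi n.*2 - psi n <= (n.*2)%:R * ln 2.
Proof.
apply: (@le_trans _ _ (ln (n.*2)`! - 2 * ln n`!)); last first.
  have := bin_fact (leq_addr n n); rewrite addnK addnn => <-.
  rewrite !ln_natM ?muln_gt0 ?fact_gt0 ?bin_gt0 -?addnn ?leq_addr //.
  rewrite (_ : _ - _ = ln 'C(n + n, n)); last by lra.
  rewrite -ln_natX // ler_ln_nat //.
  have -> : (2 ^ (n + n) = \sum_(i < (n + n).+1) 'C(n + n, i))%N.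
    rewrite -[2%N]/(1 + 1)%N expnDn; apply: eq_bigr => i _.
    by rewrite !exp1n !muln1.
  have lt_n : (n < (n + n).+1)%N by rewrite ltnS leq_addr.
  by rewrite (bigD1 (Ordinal lt_n)) //= leq_addr.
have nn2 : (n.+1 <= n.*2.+1)%N by rewrite ltnS -addnn leq_addr.
rewrite -!sum_ln_fact !sum_ln_vonM /psi.
rewrite [X in X - _ <= _](@big_cat_nat _ _ _ n.+1) //= addrAC subrr add0r.
rewrite [X in _ <= X - _](@big_cat_nat _ _ _ n.+1) //=.
rewrite addrAC -[leLHS]add0r lerD //.
  rewrite mulr_sumr -sumrB sumr_ge0 // => d _.
  rewrite mulrCA -mulrBr mulr_ge0 ?vonM_ge0 // subr_ge0 -natrM ler_nat.
  have [->|d0] := posnP d; first by rewrite divn0.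
  by rewrite leq_divRL // -muln2 (mulnC n) -mulnA leq_mul2l leq_trunc_div orbT.
rewrite big_nat [leRHS]big_nat; apply: ler_sum => d /andP[nd dn].
rewrite ler_peMr ?vonM_ge0 // ler1n divn_gt0 ?(leq_trans _ nd) //.
Qed.

(** Chebyshev's bound, by halving: with [m = uphalf n], [psi n <= psi (2m) <= psi m + 2m ln 2]. *)
Lemma psi_linear n : psi n <= 6 * ln 2 * n%:R.
Proof.
have ln2 : 0 <= ln 2 by exact: ln_nat_ge0.
have [->|n0] := posnP n; first by rewrite /psi big_geq // mulr0.
(* The induction proves the stronger bound with [n - 1], which absorbs the rounding in [uphalf]. As
   [2m <= n + 1], it closes because [4n - 2 <= 6 (n - 1)] for [n >= 2]. *)
apply: (@le_trans _ _ (6 * ln 2 * (n.-1)%:R)); last first.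
  by rewrite ler_wpM2l ?mulr_ge0 // ler_nat leq_pred.
elim/ltn_ind: n n0 => n IH n0.
have [n1|n1] := leqP n 1.
  have -> : n = 1%N by lia.
  rewrite mulr0 /psi big_nat1 /vonM big_mkcond big_nat1 /= lexx //.
have m0 : (0 < uphalf n)%N by lia.
have mn : (uphalf n < n)%N by lia.
have := IH _ mn m0.
have := psi_double (uphalf n).
have nm : (n <= (uphalf n).*2)%N by lia.
have := psi_mono nm.
set m := uphalf n in m0 mn nm *.
have : (m.*2)%:R <= n.+1%:R :> R by rewrite ler_nat /m; lia.
rewrite -natr1 -muln2 natrM.
have -> : (n.-1)%:R = n%:R - 1 :> R by rewrite -subn1 natrB.
have -> : (m.-1)%:R = m%:R - 1 :> R by rewrite -subn1 natrB.
have : 2 <= n%:R :> R by rewrite ler_nat.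
move: (psi n) (psi (m * 2)) (psi m) ln2 => a b c; move: (ln 2) => l l0.
move: (n%:R) (m%:R) => {IH n0 n1 m0 mn nm}x y => h1 h2 h3 h4 h5.
have h6 : l * (y * 2) <= l * (x + 1) by exact: ler_wpM2l.
have h7 : 0 <= l * (x - 2) by rewrite mulr_ge0 // subr_ge0.
by nra.
Qed.

(** Multiplied by [N], the sum differs from [sum_ln_vonM] only by replacing each floor [N %/ d] by
    [N / d]; this costs at most [psi N], which is linear in [N]. *)
Lemma mertens N : (0 < N)%N ->
  `|\sum_(1 <= n < N.+1) vonM n / n%:R - ln N| <= 1 + 6 * ln 2.
Proof.
move=> N0; have N0' : 0 < N%:R :> R by rewrite ltr0n.
have ln2 : 0 <= ln 2 by exact: ln_nat_ge0.
have Hge := sum_ln_ge N; have Hle := sum_ln_le N.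
rewrite sum_ln_vonM in Hge Hle.
set S := \sum_(1 <= n < N.+1) _.
have SE : N%:R * S = \sum_(1 <= n < N.+1) vonM n * (N%:R / n%:R).
  by rewrite mulr_sumr; apply: eq_bigr => n _; rewrite mulrCA.
have S1 : \sum_(1 <= d < N.+1) vonM d * (N %/ d)%:R <= N%:R * S.
  rewrite SE big_nat [leRHS]big_nat; apply: ler_sum => d /andP[d0 _].
  by rewrite ler_wpM2l ?vonM_ge0 // ler_pdivlMr ?ltr0n // -natrM ler_nat leq_trunc_div.
have S2 : N%:R * S <= \sum_(1 <= d < N.+1) vonM d * (N %/ d)%:R + psi N.
  rewrite SE /psi -big_split /= big_nat [leRHS]big_nat; apply: ler_sum => d /andP[d0 _].
  rewrite -[X in _ <= _ + X]mulr1 -mulrDr ler_wpM2l ?vonM_ge0 // natr1.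
  by rewrite ler_pdivrMr ?ltr0n // -natrM ler_nat ltnW // ltn_ceil.
have S3 := psi_linear N.
rewrite ler_norml -(ler_pM2l N0') -[_ <= 1 + _](ler_pM2l N0') mulrBr.
by apply/andP; split; nra.
Qed.

End VonMangoldt.

(** * Prime powers and summation by parts *)

Section PrimePowers.
Variable R : realType.
Local Notation ln n := (@exp.ln R n%:R).
Local Notation vonM := (@vonM R).

Lemma sum_geometric_tail (x : R) N : 1 < x ->
  \sum_(2 <= k < N.+1) x ^- k <= (x * (x - 1))^-1.
Proof.
move=> x1; have x0 : 0 < x by exact: lt_trans x1.
have x10 : 0 < x - 1 by rewrite subr_gt0.
(* The partial sum plus its exact tail is constant, which makes the induction an identity. *)
suff H M : \sum_(2 <= k < M.+2) x ^- k + x ^- M.+1 / (x - 1) = (x * (x - 1))^-1.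
  case: N => [|N]; first by rewrite big_geq // invr_ge0 mulr_ge0 // ltW.
  rewrite -(H N) lerDl mulr_ge0 ?invr_ge0 ?exprn_ge0 // ltW //.
elim: M => [|M IH]; first by rewrite big_geq // add0r expr1 invfM.
rewrite big_nat_recr //= -IH -addrA; congr (_ + _).
rewrite (exprS x M.+1) invfM; have := exprn_gt0 M.+1 x0.
by move: (x ^+ M.+1) => y y0; field; rewrite !gt_eqF.
Qed.

Lemma sum_ln_div_sqr N :
  \sum_(2 <= n < N.+1) ln n / (n%:R * (n%:R - 1)) <= 2.
Proof.
case: N => [|N]; first by rewrite big_geq.
(* Telescoping majorant: the decrease of [(ln n + 2) / n] from [m] to [m + 1] is at least
   [ln (m + 1) / ((m + 1) m)], because [(m + 1) (ln (m + 1) - ln m) <= 2]. *)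
suff : \sum_(2 <= n < N.+2) ln n / (n%:R * (n%:R - 1)) <= 2 - (ln N.+1 + 2) / N.+1%:R.
  move/le_trans; apply; rewrite gerBl mulr_ge0 ?invr_ge0 //.
  by rewrite addr_ge0 ?ln_nat_ge0.
elim: N => [|N IH]; first by rewrite big_geq // ln1 add0r divr1 subrr.
rewrite big_nat_recr //=; move: IH; set S := \sum_(_ <= _ < _) _.
move=> IH; have : ln N.+2 / (N.+2%:R * (N.+2%:R - 1)) <=
  (ln N.+1 + 2) / N.+1%:R - (ln N.+2 + 2) / N.+2%:R; last first.
  by move=> h; apply: le_trans (lerD IH h) _; rewrite addrA subrK.
have H := @ln_nat_succ R N.+1 isT.
have m0 : 0 < N.+1%:R :> R by rewrite ltr0n.
have m1 : 1 <= N.+1%:R :> R by rewrite ler1n.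
rewrite -[N.+2%:R]natr1 in H *.
move: (ln N.+1) (exp.ln _) H m0 m1 => u v; move: (N.+1%:R : R) => m H m0 m1.
have H2 : (v - u) * m <= 1 by rewrite -ler_pdivlMr ?div1r.
rewrite addrK -subr_ge0.
have -> : (u + 2) / m - (v + 2) / (m + 1) - v / ((m + 1) * m) =
  ((m + 1) * (u + 2) - m * (v + 2) - v) / ((m + 1) * m).
  by field; rewrite !gt_eqF //; lra.
apply: divr_ge0; last by apply: mulr_ge0; lra.
suff : v - u <= 1 by lra.
have [|?] := leP (v - u) 0; first by lra.
by nra.
Qed.

(** Only powers [p ^ k] with [k >= 2] contribute. For fixed [p] their geometric series gives at most
    [ln p / (p (p - 1))], and this is summed over all integers instead of primes. *)
Lemma sum_vonM_nonprime N :
  \sum_(1 <= n < N.+1 | ~~ prime n) vonM n / n%:R <= 2.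
Proof.
apply: le_trans (sum_ln_div_sqr N).
have -> : \sum_(1 <= n < N.+1 | ~~ prime n) vonM n / n%:R =
  \sum_(1 <= n < N.+1 | ~~ prime n) \sum_(1 <= p < N.+1 | prime p)
    \sum_(1 <= k < N.+1 | (p ^ k == n)%N) ln p / n%:R.
  rewrite big_nat_cond [RHS]big_nat_cond; apply: eq_bigr => n /andP[n1N _].
  rewrite (vonM_widen _ n1N) mulr_suml; apply: eq_bigr => p _.
  by rewrite mulr_suml.
rewrite (exchange_big_dep prime) //=.
rewrite (big_mkcond prime) /=.
have big2 (F : nat -> R) : F 1%N = 0 ->
    \sum_(1 <= p < N.+1) F p = \sum_(2 <= p < N.+1) F p.
  move=> F1; case: N => [|N]; first by rewrite !big_geq.
  by rewrite big_ltn // F1 add0r.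
rewrite big2 // [leLHS]big_nat [leRHS]big_nat.
apply: ler_sum => p /andP[p1 _]; case: ifP => pp; last first.
  by rewrite mulr_ge0 ?ln_nat_ge0 // invr_ge0 mulr_ge0 // subr_ge0 ler1n ltnW.
have p1' : 1 < p%:R :> R by rewrite ltr1n.
apply: le_trans (ler_wpM2l (ln_nat_ge0 _ _) (sum_geometric_tail N p1')).
rewrite (exchange_big_dep xpredT) //= mulr_sumr.
have kE k : \sum_(1 <= n < N.+1 | ~~ prime n && (p ^ k == n)%N) ln p / n%:R =
    if [&& (0 < p ^ k)%N, (p ^ k <= N)%N & ~~ prime (p ^ k)]
    then ln p / (p ^ k)%:R else 0 by exact: sum_nat_delta.
rewrite pp; under eq_bigr do under eq_bigl do rewrite andbT.
under eq_bigr do rewrite kE.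
rewrite big2; last by rewrite expn1 pp !andbF.
apply: ler_sum => k _; rewrite natrX; case: ifP => // _.
by rewrite mulr_ge0 ?ln_nat_ge0 // invr_ge0 exprn_ge0.
Qed.

End PrimePowers.

Section Abel.
Variable R : realType.
Local Notation ln n := (@exp.ln R n%:R).
Implicit Types a w : nat -> R.

Lemma abel_bound a w (C : R) m N :
    (forall N, `|\sum_(m <= n < N) a n| <= C) ->
    (forall n, (m <= n)%N -> 0 <= w n.+1 <= w n) ->
  `|\sum_(m <= n < N) a n * w n| <= C * w m.
Proof.
move=> aC w_dec.
have C0 : 0 <= C by rewrite (le_trans _ (aC m)).
have w_ge0 n : (m <= n)%N -> 0 <= w n.
  by move=> mn; have /andP[/le_trans H /H] := w_dec n mn.
have [Nm|mN] := leqP N m; first by rewrite big_geq // normr0 mulr_ge0 ?w_ge0.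
have [k {mN}->] : exists k, N = (m + k)%N by exists (N - m)%N; lia.
(* Summation by parts in inductive form: once the boundary term is subtracted, each new index costs
   at most [C] times the decrease of [w]. *)
have H : `|\sum_(m <= n < m + k) a n * w n - (\sum_(m <= n < m + k) a n) * w (m + k)%N|
   <= C * (w m - w (m + k)%N).
  elim: k => [|k IH].
    by rewrite addn0 !big_geq // mul0r !subrr mulr0 normr0.
  rewrite addnS !(big_nat_recr (m + k)) ?leq_addr //=.
  move: IH (aC (m + k).+1) (w_dec _ (leq_addr k m)).
  rewrite (big_nat_recr (m + k)) ?leq_addr //=.
  set S := \sum_(_ <= _ < _) _ * _; set T := \sum_(_ <= _ < _) _.
  move: (w m) (w (m + k)%N) (w (m + k).+1) (a (m + k)%N) => x y z b.
  rewrite !ler_norml => /andP[h1 h2] /andP[h3 h4] /andP[h5 h6].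
  have h7 : 0 <= y - z by rewrite subr_ge0.
  have h8 : 0 <= (y - z) * (C - (T + b)) by rewrite mulr_ge0 // subr_ge0.
  have h9 : 0 <= (y - z) * (T + b + C) by rewrite mulr_ge0 //; lra.
  by apply/andP; split; nra.
have Hw := w_ge0 _ (leq_addr k m).
have : `|(\sum_(m <= n < m + k) a n) * w (m + k)%N| <= C * w (m + k)%N.
  by rewrite normrM (ger0_norm Hw) ler_wpM2r.
move: H; set S := \sum_(_ <= _ < _) _ * _; set T := _ * _.
by rewrite !ler_norml => /andP[h1 h2] /andP[h3 h4]; apply/andP; split; lra.
Qed.

Lemma tail_sum_bound a (C : R) m N :
  (forall N, `|\sum_(0 <= n < N) a n| <= C) ->
  `|\sum_(m <= n < N) a n| <= 2 * C.
Proof.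
move=> aC; have C0 : 0 <= C by rewrite (le_trans _ (aC 0%N)).
have [Nm|mN] := leqP N m; first by rewrite big_geq // normr0 mulr_ge0.
have := aC N; rewrite (@big_cat_nat _ _ _ m) //= 1?ltnW //.
move: (aC m); set S := \sum_(_ <= _ < _) _; set T := \sum_(_ <= _ < _) _.
by rewrite !ler_norml => /andP[h1 h2] /andP[h3 h4]; apply/andP; split; lra.
Qed.

Lemma sum_div_nat_lim a (C : R) :
    (forall N, `|\sum_(0 <= n < N) a n| <= C) ->
  exists L : R, forall N, `|\sum_(1 <= n < N.+1) a n / n%:R - L| <= 2 * C / N.+1%:R.
Proof.
move=> aC; pose S N := \sum_(1 <= n < N.+1) a n / n%:R.
pose e N : R := 2 * C / N.+1%:R.
have C0 : 0 <= C by rewrite (le_trans _ (aC 0%N)).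
have e0 N : 0 <= e N by rewrite /e !mulr_ge0.
have S_tail m n : (m <= n)%N -> `|S n - S m| <= e m.
  move=> mn; rewrite /S [X in `|X - _|](@big_cat_nat _ _ _ m.+1) //=.
  rewrite addrAC subrr add0r.
  apply: (@abel_bound a (fun n => n%:R^-1)); first by move=> ?; exact: tail_sum_bound.
  move=> k mk; rewrite invr_ge0 ler0n lef_pV2 ?posrE ?ltr0n ?ler_nat //.
    by rewrite leqnSn.
  exact: leq_ltn_trans mk.
have Se m n : S m - e m <= S n + e n.
  have [mn|/ltnW nm] := leqP m n.
    by have := S_tail _ _ mn; have := e0 n; rewrite ler_norml => ? /andP[]; lra.
  by have := S_tail _ _ nm; have := e0 m; rewrite ler_norml => ? /andP[]; lra.
(* By [Se] every left end of the intervals from [S N - e N] to [S N + e N] is below every right end,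
   so the supremum of the left ends lies in all of them. *)
pose A := [set S N - e N | N in [set: nat]]%classic.
have A0 : (A !=set0)%classic by exists (S 0%N - e 0%N), 0%N.
have A_ub n : ubound A (S n + e n) by move=> _ [m _ <-].
exists (sup A) => N; rewrite -/(S N) -/(e N) ler_norml; apply/andP; split.
  by rewrite lerBrDl lerBlDr; exact: ge_sup.
rewrite lerBlDl -lerBlDr; apply: ub_le_sup; last by exists N.
by exists (S 0%N + e 0%N).
Qed.

Lemma sum_ln_div_nat_bound a (C : R) :
    (forall N, `|\sum_(0 <= n < N) a n| <= C) ->
  exists C' : R, forall N, `|\sum_(1 <= n < N.+1) a n * (ln n / n%:R)| <= C'.
Proof.
move=> aC; have C0 : 0 <= C by rewrite (le_trans _ (aC 0%N)).
(* The weights [ln n / n] decrease once [ln n >= 1]. The cutoff 4 is convenient as [ln 4 = 2 ln 2]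
   and [ln (1/2) <= -1/2]; the terms below it go into the constant. *)
have ln4 : 1 <= ln 4.
  have -> : ln 4 = 2 * ln 2 by rewrite -ln_natX.
  have h : -1 < - (1/2) :> R by lra.
  have := le_ln1Dx h; rewrite (_ : 1 + - (1/2) = 2^-1); last by field.
  rewrite lnV ?posrE ?ltr0n // => h2. lra.
pose w n := ln n / n%:R.
have w_ge0 n : 0 <= w n by rewrite divr_ge0 ?ln_nat_ge0.
have w_dec n : (4 <= n)%N -> 0 <= w n.+1 <= w n.
  move=> n4; rewrite w_ge0 /= /w.
  have n0 : 0 < n%:R :> R by rewrite ltr0n; lia.
  rewrite ler_pdivrMr ?ltr0n // mulrAC ler_pdivlMr // -[in leRHS]natr1.
  have /(@ln_nat_succ R) : (0 < n)%N by lia.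
  have := @ler_ln_nat R _ _ n4.
  move: (n%:R) n0 (ln n) (ln n.+1) => z z0 x y h1 h2.
  have : (y - x) * z <= 1 by rewrite -ler_pdivlMr // div1r.
  by lra.
exists (\sum_(1 <= n < 4) `|a n * w n| + 2 * C * w 4%N) => N.
have H k : `|\sum_(4 <= n < k) a n * w n| <= 2 * C * w 4%N.
  by apply: abel_bound => // ?; exact: tail_sum_bound.
have [N4|N4] := ltnP N 4; last first.
  rewrite (@big_cat_nat _ _ _ 4) //= 1?ltnW //.
  by apply: (le_trans (ler_normD _ _)); apply: lerD => //; exact: ler_norm_sum.
apply: (le_trans (ler_norm_sum _ _ _)).
rewrite [X in _ <= X + _](@big_cat_nat _ _ _ N.+1) //= -addrA lerDl addr_ge0 //.
  by apply: sumr_ge0.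
by rewrite mulr_ge0 // mulr_ge0.
Qed.

End Abel.

(** * Mertens sums twisted by a character *)

(** Both sides run over the pairs [(d, e)] with [d * e] dividing [n]. *)
Lemma exchange_divisors (V : nmodType) (F : nat -> nat -> V) n : (0 < n)%N ->
  \sum_(1 <= d < n.+1 | (d %| n)%N)
    \sum_(1 <= e < (n %/ d).+1 | (e %| n %/ d)%N) F d e =
  \sum_(1 <= e < n.+1 | (e %| n)%N)
    \sum_(1 <= d < (n %/ e).+1 | (d %| n %/ e)%N) F d e.
Proof.
move=> n0.
have widen (G : nat -> V) d : (d %| n)%N ->
    \sum_(1 <= e < (n %/ d).+1 | (e %| n %/ d)%N) G e =
    \sum_(1 <= e < n.+1 | (e * d %| n)%N) G e.
  move=> dn; have d0 := dvdn_gt0 n0 dn.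
  have nd0 : (0 < n %/ d)%N by rewrite divn_gt0 // (dvdn_leq n0 dn).
  rewrite (big_nat_widen _ _ n.+1); last by rewrite ltnS leq_div.
  apply: eq_bigl => e; rewrite ltnS -dvdn_divRL //.
  by case: (boolP (e %| _)%N) => // /(dvdn_leq nd0) ->.
under eq_bigr => d dn do rewrite widen //.
under [RHS]eq_bigr => d dn do rewrite widen //.
rewrite (exchange_big_dep (fun e => e %| n)%N) /=; last first.
  by move=> d e _; exact/dvdn_trans/dvdn_mulr.
apply: eq_bigr => e en; apply: eq_bigl => d.
rewrite mulnC; case: (boolP (d * e %| n)%N); rewrite ?andbF // andbT.
by move/(dvdn_trans (dvdn_mulr e (dvdnn d))).
Qed.

(** Moebius inversion of [sum_divisors_vonM]: after exchanging the divisor sums, [sum_mobius] leaves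
    only the term [e = n]. *)
Lemma sum_mobius_ln (R : realType) n : (0 < n)%N ->
  \sum_(1 <= d < n.+1 | (d %| n)%N) (mobius d)%:~R * exp.ln (n %/ d)%:R = vonM R n.
Proof.
move=> n0.
transitivity (\sum_(1 <= d < n.+1 | (d %| n)%N)
  \sum_(1 <= e < (n %/ d).+1 | (e %| n %/ d)%N) (mobius d)%:~R * vonM R e).
  apply: eq_bigr => d dn; rewrite -mulr_sumr sum_divisors_vonM //.
  by rewrite divn_gt0 ?(dvdn_leq n0 dn) ?(dvdn_gt0 n0 dn).
rewrite exchange_divisors //.
transitivity (\sum_(1 <= e < n.+1 | true && (n == e)) vonM R e); last first.
  by rewrite sum_nat_delta n0 leqnn.
rewrite big_mkcond [RHS]big_mkcond; apply: eq_big_nat => e /andP[e0 _] /=.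
case: ifPn => [en|]; last by case: eqP => // ->; rewrite dvdnn.
rewrite -mulr_suml -raddf_sum sum_mobius ?divn_gt0 ?(dvdn_leq n0 en) //.
have -> : (n %/ e == 1)%N = (n == e).
  by rewrite -{2}(divnK en) -[X in _ = (_ == X)]mul1n eqn_pmul2r.
by case: eqP; rewrite ?mul1r ?mul0r.
Qed.

Section ComplexNorm.
Local Open Scope complex_scope.
Variable R : realType.
Local Notation nm := (@Normc.normc R).
Implicit Types z : R[i].

Lemma normc_ge0 z : 0 <= nm z. Proof. by case: z => a b; rewrite sqrtr_ge0. Qed.
Lemma normcD z1 z2 : nm (z1 + z2) <= nm z1 + nm z2. Proof. exact: le_normcD. Qed.
Lemma normcB z1 z2 : nm (z1 - z2) <= nm z1 + nm z2.
Proof. by rewrite -(normcN z2); exact: normcD. Qed.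

Lemma normc_sum (I : Type) (r : seq I) (P : pred I) (F : I -> R[i]) :
  nm (\sum_(i <- r | P i) F i) <= \sum_(i <- r | P i) nm (F i).
Proof.
apply: (big_ind2 (fun x y => nm x <= y)) => //; first by rewrite Normc.normc0.
by move=> x y z t h1 h2; apply: (le_trans (normcD _ _)); exact: lerD.
Qed.

Lemma normc_real (x : R) : nm x%:C = `|x|.
Proof. by rewrite /= expr0n /= addr0 sqrtr_sqr. Qed.

Lemma normc_Re z : `|complex.Re z| <= nm z.
Proof.
by case: z => a b /=; rewrite -sqrtr_sqr ler_sqrt ?addr_ge0 ?sqr_ge0 // lerDl sqr_ge0.
Qed.

Lemma normc_Im z : `|complex.Im z| <= nm z.
Proof.
by case: z => a b /=; rewrite -sqrtr_sqr ler_sqrt ?addr_ge0 ?sqr_ge0 // lerDr sqr_ge0.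
Qed.

Lemma normc_le z : nm z <= `|complex.Re z| + `|complex.Im z|.
Proof.
case: z => a b /=; rewrite -[leRHS]ger0_norm ?addr_ge0 // -sqrtr_sqr.
rewrite ler_sqrt ?sqr_ge0 // sqrrD -(real_normK (num_real a)) -(real_normK (num_real b)).
by rewrite lerD2r lerDl mulrn_wge0 // mulr_ge0.
Qed.

Lemma Re_sum (I : Type) (r : seq I) (P : pred I) (F : I -> R[i]) :
  complex.Re (\sum_(i <- r | P i) F i) = \sum_(i <- r | P i) complex.Re (F i).
Proof. by apply: (big_morph (@complex.Re R)) => // -[a b] [c d]. Qed.

Lemma Im_sum (I : Type) (r : seq I) (P : pred I) (F : I -> R[i]) :
  complex.Im (\sum_(i <- r | P i) F i) = \sum_(i <- r | P i) complex.Im (F i).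
Proof. by apply: (big_morph (@complex.Im R)) => // -[a b] [c d]. Qed.

Lemma ReM_real z (x : R) : complex.Re (z * x%:C) = complex.Re z * x.
Proof. by case: z => a b /=; rewrite mulr0 subr0. Qed.

Lemma ImM_real z (x : R) : complex.Im (z * x%:C) = complex.Im z * x.
Proof. by case: z => a b /=; rewrite mulr0 add0r. Qed.

End ComplexNorm.

Section Mertens.
Local Open Scope complex_scope.
Variable R : realType.
Local Notation nm := (@Normc.normc R).
Local Notation ln n := (@exp.ln R n%:R).
Local Notation vonM := (@vonM R).
Variables (chi : nat -> R[i]) (B : R).
Hypothesis chi1 : chi 1%N = 1.
Hypothesis chiM : forall m n, chi (m * n)%N = chi m * chi n.
Hypothesis chi_le1 : forall n, nm (chi n) <= 1.
Hypothesis chi_sum : forall N, nm (\sum_(0 <= n < N) chi n) <= B.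

(** [S] and [M] are the partial sums at 1 of the Dirichlet series of [L] and of [- L' / L] for
    [chi]. *)
Let S N := \sum_(1 <= n < N.+1) chi n * (n%:R^-1)%:C.
Let M N := \sum_(1 <= n < N.+1) chi n * (vonM n / n%:R)%:C.

Let B0 : 0 <= B. Proof. exact: le_trans (normc_ge0 _) (chi_sum 0). Qed.

Let chi_Re N : `|\sum_(0 <= n < N) complex.Re (chi n)| <= B.
Proof. by rewrite -Re_sum (le_trans (normc_Re _)). Qed.

Let chi_Im N : `|\sum_(0 <= n < N) complex.Im (chi n)| <= B.
Proof. by rewrite -Im_sum (le_trans (normc_Im _)). Qed.

Let S_lim : exists L : R[i], forall N, nm (S N - L) <= 4 * B / N.+1%:R.
Proof.
have [L1 h1] := sum_div_nat_lim chi_Re; have [L2 h2] := sum_div_nat_lim chi_Im.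
exists (L1 +i* L2) => N; apply: (le_trans (normc_le _)).
have -> : 4 * B / N.+1%:R = 2 * B / N.+1%:R + 2 * B / N.+1%:R.
  by rewrite -mulrDl -mulrDl -natrD.
rewrite /S; apply: lerD.
  rewrite (_ : complex.Re _ = \sum_(1 <= n < N.+1) complex.Re (chi n) / n%:R - L1) //.
  transitivity (complex.Re (\sum_(1 <= n < N.+1) chi n * (n%:R^-1)%:C) - L1).
    by case: (\sum_(_ <= _ < _) _).
  by rewrite Re_sum; congr (_ - _); apply: eq_bigr => n _; rewrite ReM_real.
rewrite (_ : complex.Im _ = \sum_(1 <= n < N.+1) complex.Im (chi n) / n%:R - L2) //.
transitivity (complex.Im (\sum_(1 <= n < N.+1) chi n * (n%:R^-1)%:C) - L2).
  by case: (\sum_(_ <= _ < _) _).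
by rewrite Im_sum; congr (_ - _); apply: eq_bigr => n _; rewrite ImM_real.
Qed.

Let sum_chi_ln_bound :
  exists C : R, forall N, nm (\sum_(1 <= n < N.+1) chi n * (ln n / n%:R)%:C) <= C.
Proof.
have [C1 h1] := sum_ln_div_nat_bound chi_Re; have [C2 h2] := sum_ln_div_nat_bound chi_Im.
exists (C1 + C2) => N; apply: (le_trans (normc_le _)).
rewrite Re_sum Im_sum; apply: lerD.
  by under eq_bigr do rewrite ReM_real.
by under eq_bigr do rewrite ImM_real.
Qed.

(** Writing [n = d m], complete multiplicativity splits [chi n / n], and the inner sum over
    [m <= N / d] is a partial sum of [L(1, chi)]. *)
Let twisted_convolution (a : nat -> R) N :
  \sum_(1 <= n < N.+1) chi n *
      ((\sum_(1 <= d < n.+1 | (d %| n)%N) a d) / n%:R)%:C =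
  \sum_(1 <= d < N.+1) chi d * (a d / d%:R)%:C * S (N %/ d).
Proof.
pose F d m := chi d * (a d / d%:R)%:C * (chi m * (m%:R^-1)%:C).
transitivity (\sum_(1 <= n < N.+1) \sum_(1 <= d < n.+1 | (d %| n)%N) F d (n %/ d)%N).
  apply: eq_bigr => n _; rewrite mulr_suml raddf_sum mulr_sumr.
  apply: eq_bigr => d dn; rewrite /F mulrACA -chiM mulnC divnK // -rmorphM /=.
  congr (_ * _%:C); rewrite -{1}(divnK dn) natrM invfM.
  by rewrite (mulrC (n %/ d)%:R^-1) mulrA.
rewrite sum_divisor_pairs; apply: eq_bigr => d _.
by rewrite /S mulr_sumr.
Qed.

Let inv_floor_le d N : (0 < d)%N -> (0 < N)%N -> (N %/ d).+1%:R^-1 <= d%:R / N%:R :> R.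
Proof.
move=> d0 N0; rewrite -div1r ler_pdivrMr ?ltr0n // mulrAC ler_pdivlMr ?ltr0n //.
by rewrite mul1r -natrM ler_nat mulnC ltnW // ltn_ceil.
Qed.

(* [z] tells whether [L(1, chi) = 0]. *)
Lemma mertens_character : exists (z : bool) (C : R), forall N, (0 < N)%N ->
  nm (M N + (z%:R * ln N)%:C) <= C.
Proof.
have [L SL] := S_lim.
have SL' d N : (0 < d)%N -> (0 < N)%N -> nm (S (N %/ d) - L) <= 4 * B * (d%:R / N%:R).
  move=> d0 N0; apply: (le_trans (SL _)); rewrite ler_wpM2l ?mulr_ge0 //.
  exact: inv_floor_le.
exists (L == 0); have [L0|Ln0] := eqVneq L 0.
  exists (4 * B) => N N0; have N0' : 0 < N%:R :> R by rewrite ltr0n.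
  (* The divisor sum of [a] at [n] is [vonM n], plus [ln N] when [n = 1]; the convolution therefore
     produces [M N + ln N]. *)
  pose a d : R := (mobius d)%:~R * (ln N - ln d).
  have -> : M N + (true%:R * ln N)%:C =
      \sum_(1 <= d < N.+1) chi d * (a d / d%:R)%:C * S (N %/ d).
    rewrite -twisted_convolution.
    transitivity (\sum_(1 <= n < N.+1) chi n *
        ((vonM n + (n == 1)%:R * ln N) / n%:R)%:C); last first.
      apply: eq_big_nat => n /andP[n0 nN]; congr (_ * (_ / _)%:C).
      transitivity (\sum_(1 <= d < n.+1 | (d %| n)%N) ((mobius d)%:~R * ln (n %/ d)%N +
          (mobius d)%:~R * (ln N - ln n))).
        rewrite big_split /= sum_mobius_ln //; congr (_ + _).
        rewrite -mulr_suml -raddf_sum sum_mobius //.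
        by case: eqP => [->|_]; rewrite ?mul0r // ln1 subr0.
      apply: eq_bigr => d dn; rewrite -mulrDr /a.
      have d0 := dvdn_gt0 n0 dn.
      have -> : ln n = ln (n %/ d)%N + ln d.
        by rewrite -ln_natM ?divnK // divn_gt0 // (dvdn_leq n0 dn).
      by congr (_ * _); ring.
    under [RHS]eq_bigr do rewrite mulrDl rmorphD mulrDr.
    rewrite big_split /=; congr (_ + _).
    rewrite big_ltn // big_nat big1 ?addr0 => [|n /andP[n1 _]].
      by rewrite chi1 mul1r divr1.
    by rewrite gtn_eqF // mul0r mul0r mulr0.
  apply: (le_trans (normc_sum _ _ _)).
  (* As [L = 0], the factor [S (N %/ d)] is itself at most [4 B d / N]. The total [N ln N - ln N!]
     is at most [N] by [sum_ln_ge]. *)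
  apply: (@le_trans _ _ (\sum_(1 <= d < N.+1) 4 * B / N%:R * (ln N - ln d))).
    rewrite big_nat [leRHS]big_nat; apply: ler_sum => d /andP[d0 dN].
    have dN' : 0 <= ln N - ln d by rewrite subr_ge0 ler_ln_nat.
    have d0' : 0 < d%:R :> R by rewrite ltr0n.
    rewrite !Normc.normcM normc_real -mulrA.
    apply: (@le_trans _ _ (1 * ((ln N - ln d) / d%:R * (4 * B * (d%:R / N%:R))))).
      apply: ler_pM => //; rewrite ?normc_ge0 ?mulr_ge0 ?normc_ge0 //.
      apply: ler_pM; rewrite ?normc_ge0 //; last first.
        by have := SL' _ _ d0 N0; rewrite L0 subr0.
      rewrite normrM [X in _ * X]ger0_norm ?invr_ge0 // ler_wpM2r ?invr_ge0 //.
      rewrite /a normrM (ger0_norm dN') ler_piMl // -intr_norm.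
      have := norm_mobius d; by rewrite -(ler_int R).
    rewrite mul1r le_eqVlt; apply/orP; left; apply/eqP; field.
    by rewrite !gt_eqF.
  rewrite -mulr_sumr sumrB sumr_const_nat subn1 /= -mulrA ler_piMr ?mulr_ge0 //.
  rewrite mulrC ler_pdivrMr // mul1r -[ln N *+ N]mulr_natl.
  by have := sum_ln_ge R N; lra.
(* For [L <> 0], the bounded sum of [chi n ln n / n] is the convolution of [vonM] with [S];
   replacing [S (N %/ d)] by [L] turns it into [L * M N] at a cost of at most [4 B psi N / N]. *)
have [C1 hC1] := sum_chi_ln_bound.
exists (nm L^-1 * (C1 + 4 * B * (6 * ln 2))) => N N0; have N0' : 0 < N%:R :> R by rewrite ltr0n.
rewrite mul0r addr0 -[M N](mulKf Ln0) Normc.normcM ler_wpM2l ?normc_ge0 //.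
have conv : \sum_(1 <= n < N.+1) chi n * (ln n / n%:R)%:C =
    \sum_(1 <= d < N.+1) chi d * (vonM d / d%:R)%:C * S (N %/ d).
  rewrite -twisted_convolution; apply: eq_big_nat => n /andP[n0 _].
  by rewrite sum_divisors_vonM.
have -> : L * M N = \sum_(1 <= n < N.+1) chi n * (ln n / n%:R)%:C -
   \sum_(1 <= d < N.+1) chi d * (vonM d / d%:R)%:C * (S (N %/ d) - L).
  rewrite conv -sumrB /M mulr_sumr; apply: eq_bigr => d _.
  by rewrite -mulrBr opprB addrC subrK mulrC.
apply: (le_trans (normcB _ _)); apply: lerD => //.
apply: (le_trans (normc_sum _ _ _)).
apply: (@le_trans _ _ (\sum_(1 <= d < N.+1) 4 * B / N%:R * vonM d)).
  rewrite big_nat [leRHS]big_nat; apply: ler_sum => d /andP[d0 dN].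
  have d0' : 0 < d%:R :> R by rewrite ltr0n.
  have v0 := vonM_ge0 R d.
  rewrite !Normc.normcM normc_real -mulrA.
  apply: (@le_trans _ _ (1 * (vonM d / d%:R * (4 * B * (d%:R / N%:R))))).
    apply: ler_pM => //; rewrite ?normc_ge0 ?mulr_ge0 ?normc_ge0 //.
    apply: ler_pM; rewrite ?normc_ge0 //; last exact: SL'.
    by rewrite ger0_norm // divr_ge0.
  rewrite mul1r le_eqVlt; apply/orP; left; apply/eqP; field.
  by rewrite !gt_eqF.
rewrite -mulr_sumr -/(psi R N) -mulrA ler_wpM2l ?mulr_ge0 //.
by rewrite mulrC ler_pdivrMr //; exact: psi_linear.
Qed.

End Mertens.

(** * Characters of a finite field *)

(** [X^n - 1] splits and is separable in characteristic 0, and [n] distinct [n]-th roots of unity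
    include a primitive one. *)
Lemma closed_prim_root_exists (C : numClosedFieldType) n : (0 < n)%N ->
  exists z : C, n.-primitive_root z.
Proof.
pose p : {poly C} := 'X^n - 1; have [r Dp] := closed_field_poly_normal p.
move=> n_gt0; rewrite (monicP _) ?monicXnsubC // scale1r in Dp.
have rn1 : all n.-unity_root r by apply/allP => z; rewrite -root_prod_XsubC -Dp.
have sz_r : (n < (size r).+1)%N.
  by rewrite -(size_prod_XsubC r id) -Dp size_XnsubC.
have [|z] := hasP (has_prim_root n_gt0 rn1 _ sz_r); last by exists z.
by rewrite -separable_prod_XsubC -Dp cyclotomic.separable_Xn_sub_1 // pnatr_eq0 -lt0n.
Qed.

Lemma finField_prim_root_exists (F : finFieldType) :
  exists g : F, #|F|.-1.-primitive_root g.
Proof.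
have F1 : (0 < #|F|.-1)%N by rewrite -subn1 subn_gt0 finNzRing_gt1.
pose rs := enum (predC1 (0 : F)).
have rs1 : all #|F|.-1.-unity_root rs.
  apply/allP => x; rewrite mem_enum inE /= => x0; rewrite unity_rootE.
  rewrite -(inj_eq (mulfI x0)) mulr1 -exprS prednK ?expf_card //.
  exact: ltn_trans (finNzRing_gt1 F).
have [||z] := hasP (has_prim_root F1 rs1 _ _).
- exact: enum_uniq.
- by rewrite -cardE cardC1.
by exists z.
Qed.

Section Characters.
Local Open Scope complex_scope.
Variables (R : realType) (F : finFieldType).
Local Notation m := (#|F|.-1).
Local Notation nm := (@Normc.normc R).

Variables (g : F) (w : R[i]).
Hypotheses (g_prim : m.-primitive_root g) (w_prim : m.-primitive_root w).

(** Discrete logarithm to base [g]. The default 0 is reached only at [x = 0], which [mult_char]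
    treats apart. *)
Let dlog (x : F) : nat := if [pick i : 'I_m | x == g ^+ i] is Some i then i else 0.

Let dlogK x : x != 0 -> g ^+ dlog x = x.
Proof.
move=> x0; have xm : x ^+ m = 1.
  apply: (mulfI x0); rewrite mulr1 -exprS prednK ?expf_card //.
  exact: ltn_trans (finNzRing_gt1 F).
rewrite /dlog; case: pickP => [i /eqP-> //|].
by have [i ->] := prim_rootP g_prim xm; move/(_ i); rewrite eqxx.
Qed.

Definition unit_char (x : F) : R[i] := w ^+ dlog x.

Let unit_charX k : unit_char (g ^+ k) = w ^+ k.
Proof.
apply/eqP; rewrite /unit_char (eq_prim_root_expr w_prim).
rewrite -(eq_prim_root_expr g_prim) dlogK // expf_neq0 //.
by rewrite (prim_root_eq0 g_prim) -lt0n -subn1 subn_gt0 finNzRing_gt1.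
Qed.

(** As [j] runs below [m], these are all the multiplicative characters, extended by 0: powers of one
    generator, with [j = 0] the principal one. *)
Definition mult_char (j : nat) (x : F) : R[i] :=
  if x == 0 then 0 else unit_char x ^+ j.

Lemma mult_char1 j : mult_char j 1 = 1.
Proof. by rewrite /mult_char oner_eq0 -(expr0 g) unit_charX expr0 expr1n. Qed.

Lemma mult_charM j : {morph mult_char j : x y / x * y}.
Proof.
move=> x y; rewrite /mult_char mulf_eq0.
have [->|x0] := eqVneq x 0; first by rewrite /= mul0r.
have [->|y0] := eqVneq y 0; first by rewrite orbT mulr0.
by rewrite -exprMn -{1}(dlogK x0) -{1}(dlogK y0) -exprD unit_charX exprD.
Qed.

Lemma unit_charXm x : unit_char x ^+ m = 1.
Proof. by rewrite /unit_char -exprM mulnC exprM (prim_expr_order w_prim) expr1n. Qed.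

Let m_gt0 : (0 < m)%N.
Proof. by rewrite -subn1 subn_gt0 finNzRing_gt1. Qed.

Lemma normc_mult_char j x : nm (mult_char j x) <= 1.
Proof.
rewrite /mult_char; case: ifP => _; first by rewrite Normc.normc0.
have nmX z k : nm (z ^+ k) = nm z ^+ k.
  elim: k => [|k IH]; first by rewrite !expr0 Normc.normc1.
  by rewrite !exprS Normc.normcM IH.
have : nm (unit_char x) ^+ m = 1 by rewrite -nmX unit_charXm Normc.normc1.
move/eqP; rewrite pexpr_eq1 ?normc_ge0 // => /eqP x1.
by rewrite nmX x1 expr1n.
Qed.

(** Replacing [x] by [x * g] multiplies the sum by [mult_char j g = w ^+ j], which is not 1. *)
Lemma sum_mult_char j : (0 < j < m)%N -> \sum_x mult_char j x = 0.
Proof.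
move=> /andP[j0 jm]; have g0 : g != 0 by rewrite (prim_root_eq0 g_prim) -lt0n.
set T := \sum_x _; have gT : T * mult_char j g = T.
  rewrite {2}/T (reindex_inj (mulIf g0)) /T mulr_suml.
  by apply: eq_bigr => x _; rewrite mult_charM.
apply/eqP; move/eqP: gT; rewrite -subr_eq0 -{2}[T]mulr1 -mulrBr mulf_eq0.
case/orP => // /idPn[]; rewrite subr_eq0 /mult_char (negbTE g0).
rewrite -[g]expr1 unit_charX expr1 -(expr0 w) (eq_prim_root_expr w_prim).
by rewrite mod0n modn_small // -lt0n.
Qed.

(** For [x] nonzero this is a geometric sum in an [m]-th root of unity that equals 1 only for
    [x = 1]. *)
Lemma mult_char_orthogonal x :
  \sum_(j < m) mult_char j x = if x == 1 then m%:R else 0.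
Proof.
have [->|x1] := eqVneq x 1.
  by under eq_bigr do rewrite mult_char1; rewrite sumr_const card_ord.
rewrite /mult_char; have [_|x0] := eqVneq x 0; first by rewrite big1.
apply/eqP; have := subrX1 (unit_char x) m; rewrite unit_charXm subrr => /esym/eqP.
rewrite mulf_eq0 => /orP[|//]; rewrite subr_eq0 /unit_char -(expr0 w).
rewrite (eq_prim_root_expr w_prim) -(eq_prim_root_expr g_prim) dlogK // expr0.
by rewrite (negbTE x1).
Qed.

End Characters.

Section Periodic.
Local Open Scope complex_scope.
Variables (R : realType) (q : nat) (H : 'F_q -> R[i]).
Hypothesis q_prime : prime q.
Local Notation nm := (@Normc.normc R).

Lemma sum_period : \sum_(0 <= n < q) H n%:R = \sum_x H x.
Proof.
rewrite -{1}(Fp_cast q_prime) big_mkord; apply: eq_bigr => x _.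
by rewrite natr_Zp.
Qed.

(** Whole periods contribute 0 and are removed one at a time; at most [q] terms of norm at most 1
    remain. *)
Lemma periodic_sum_bound : (forall x, nm (H x) <= 1) -> \sum_x H x = 0 ->
  forall N, nm (\sum_(0 <= n < N) H n%:R) <= q%:R.
Proof.
move=> H1 H0 N; have q0 := prime_gt0 q_prime.
elim/ltn_ind: N => N IH; have [Nq|qN] := leqP N q.
  apply: (le_trans (normc_sum _ _ _)).
  apply: (@le_trans _ _ (\sum_(0 <= n < N) 1)); first exact: ler_sum.
  by rewrite sumr_const_nat subn0 ler_nat.
rewrite (@big_cat_nat _ _ _ q) //= 1?ltnW // sum_period H0 add0r.
rewrite -{1}(add0n q) big_addn.
under eq_bigr do rewrite natrD pchar_Fp_0 // addr0.
by apply: IH; rewrite -subn_gt0 subKn // ltnW.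
Qed.

End Periodic.

(** * Primes congruent to 1 modulo a prime *)

Section PrimesModPrime.
Local Open Scope complex_scope.
Variables (R : realType).
Local Notation nm := (@Normc.normc R).
Local Notation ln n := (@exp.ln R n%:R).
Local Notation vonM := (@vonM R).

Lemma mertens_primes : exists C : R, forall N, (0 < N)%N ->
  `|\sum_(1 <= p < N.+1 | prime p) ln p / p%:R - ln N| <= C.
Proof.
exists (1 + 6 * ln 2 + 2) => N N0.
have := mertens R N0; rewrite (bigID prime) /=.
rewrite (eq_bigr (fun p => ln p / p%:R)) => [|p pp]; last by rewrite vonM_prime.
have : 0 <= \sum_(1 <= n < N.+1 | ~~ prime n) vonM n / n%:R.
  by apply: sumr_ge0 => n _; rewrite divr_ge0 ?vonM_ge0.
have := sum_vonM_nonprime R N.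
move: (\sum_(_ <= _ < _ | prime _) _) (\sum_(_ <= _ < _ | ~~ _) _) => x y h1 h2.
by rewrite !ler_norml => /andP[h3 h4]; apply/andP; split; lra.
Qed.

(** Prime powers cost at most 2. The coefficient of [ln N] is stated as an integer so that it can be
    added to the coefficient 1 of the principal character. *)
Lemma mertens_character_primes (chi : nat -> R[i]) (B : R) :
    chi 1%N = 1 -> (forall m n, chi (m * n)%N = chi m * chi n) ->
    (forall n, nm (chi n) <= 1) ->
    (forall N, nm (\sum_(0 <= n < N) chi n) <= B) ->
  exists (z : bool) (C : R), forall N, (0 < N)%N ->
    nm (\sum_(1 <= p < N.+1 | prime p) chi p * (ln p / p%:R)%:C -
        ((- (z%:Z))%:~R * ln N)%:C) <= C.
Proof.
move=> chi1 chiM chi_le1 chi_sum.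
have [z [C H]] := mertens_character chi1 chiM chi_le1 chi_sum.
exists z, (C + 2) => N N0; have := H N N0; rewrite (bigID prime) /=.
under eq_bigr => p pp do rewrite vonM_prime //.
have : nm (\sum_(1 <= n < N.+1 | ~~ prime n) chi n * (vonM n / n%:R)%:C) <= 2.
  apply: (le_trans (normc_sum _ _ _)); apply: le_trans (sum_vonM_nonprime R N).
  apply: ler_sum => n _; rewrite Normc.normcM normc_real ger0_norm ?ler_piMl //.
  - by rewrite divr_ge0 ?vonM_ge0.
  - by rewrite divr_ge0 ?vonM_ge0.
set X := \sum_(_ <= _ < _ | prime _) _; set Y := \sum_(_ <= _ < _ | ~~ _) _.
move=> hY hX; rewrite rmorphN mulNr rmorphN opprK.
have -> : X + (z%:Z%:~R * ln N)%:C = X + Y + (z%:R * ln N)%:C - Y.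
  by rewrite pmulrn addrAC addrK.
exact: le_trans (normcB _ _) (lerD hX hY).
Qed.

Lemma ln_unbounded (C : R) : exists2 N, (0 < N)%N & C < ln N.
Proof.
have := archi_boundP (expR_ge0 C); set N := Num.bound _ => eN.
have N0 : (0 < N)%N by rewrite -(ltr_nat R) (le_lt_trans _ eN) ?expR_ge0.
by exists N => //; rewrite -(expRK C) ltr_ln ?posrE ?expR_gt0 ?ltr0n.
Qed.

(* [c = 0] would be the case where [L(1, chi) = 0] for some [chi]. *)
Lemma mertens_primes_mod1 q : prime q -> (2 < q)%N ->
  exists2 c : R, 0 <= c <= (q.-1)%:R^-1 &
  exists C : R, forall N, (0 < N)%N ->
    `|\sum_(1 <= p < N.+1 | prime p) ((p %% q == 1)%N%:R - c) * (ln p / p%:R)| <= C.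
Proof.
move=> q_pr q2; have [g g_prim] := finField_prim_root_exists 'F_q.
have m0 : (0 < #|'F_q|.-1)%N by rewrite card_Fp //; lia.
have [w w_prim] := closed_prim_root_exists R[i] m0.
have Em : #|'F_q|.-1 = q.-1 by rewrite card_Fp.
rewrite -Em; set m := #|'F_q|.-1 in m0 g_prim w_prim Em *.
pose chi j n := mult_char g w j (n%:R : 'F_q).
pose M j N := \sum_(1 <= p < N.+1 | prime p) chi j p * (ln p / p%:R)%:C.
have [K hK] := mertens_primes.
have chi_asymp (j : 'I_m) : exists aC : int * R,
    (aC.1 <= (j == 0 :> nat)%:Z) /\
    forall N, (0 < N)%N -> nm (M j N - (aC.1%:~R * ln N)%:C) <= aC.2.
  have [j0|j0] := eqVneq (j : nat) 0.
    (* The principal character omits at most the prime [q], whose term is bounded by [ln q]. *)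
    exists (1, K + ln q) => /=; split => // N N0.
    pose S : R := \sum_(1 <= p < N.+1 | prime p && (q == p)) ln p / p%:R.
    have -> : M j N = (\sum_(1 <= p < N.+1 | prime p) ln p / p%:R)%:C - S%:C.
      rewrite /M /S (big_mkcondr) /= -rmorphB -sumrB rmorph_sum.
      apply: eq_bigr => p pp; rewrite /chi /mult_char j0 expr0.
      have -> : (p%:R == 0 :> 'F_q) = (q == p).
        by rewrite -(dvdn_pcharf (pchar_Fp q_pr)) dvdn_prime2.
      by case: eqP => _; rewrite ?subrr ?subr0 ?mul0r ?mul1r.
    rewrite -rmorphB -rmorphB normc_real mul1r.
    have S_bound : `|S| <= ln q.
      rewrite /S sum_nat_delta; case: ifP => _; last by rewrite normr0 ln_nat_ge0.
      rewrite ger0_norm ?divr_ge0 ?ln_nat_ge0 //.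
      by rewrite ler_pdivrMr ?ltr0n ?prime_gt0 // ler_peMr ?ln_nat_ge0 // ler1n prime_gt0.
    rewrite addrAC; apply: (le_trans (ler_normB _ _)); apply: lerD => //.
    exact: hK.
  have chi_le1 x : nm (mult_char g w j x) <= 1 by apply: normc_mult_char.
  have chi_sum0 : \sum_x mult_char g w j x = 0.
    by apply: sum_mult_char => //; rewrite lt0n j0 ltn_ord.
  have chiM a b : chi j (a * b)%N = chi j a * chi j b.
    by rewrite /chi natrM mult_charM.
  have [z [C hC]] := mertens_character_primes (mult_char1 g_prim w_prim j) chiM
    (fun n => chi_le1 n%:R) (periodic_sum_bound q_pr chi_le1 chi_sum0).
  by exists (- z%:Z, C) => /=; split => //; case: z {hC}.
have [aC haC] := choice chi_asymp.
pose a j := (aC j).1; pose A := \sum_j a j; pose C := \sum_j (aC j).2.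
have A1 : A <= 1.
  rewrite -(_ : \sum_(j < m) (j == 0 :> nat)%:Z = 1).
    by apply: ler_sum => j _; exact: (haC j).1.
  rewrite (bigD1 (Ordinal m0)) //= big1 // => j.
  by rewrite -val_eqE /= => /negbTE ->.
pose T N := \sum_(1 <= p < N.+1 | prime p) (p %% q == 1)%N%:R * (ln p / p%:R).
have T_bound N : (0 < N)%N -> `|m%:R * T N - A%:~R * ln N| <= C.
  move=> N0; rewrite -normc_real.
  (* Orthogonality: summing over all characters isolates the primes congruent to 1, with weight
     [m]. *)
  have -> : (m%:R * T N - A%:~R * ln N)%:C =
      \sum_(j < m) (M j N - ((a j)%:~R * ln N)%:C).
    rewrite sumrB rmorphB; congr (_ - _); last first.
      by rewrite -rmorph_sum -mulr_suml -rmorph_sum.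
    rewrite exchange_big /= mulr_sumr rmorph_sum; apply: eq_bigr => p pp.
    rewrite -mulr_suml mult_char_orthogonal // mulrA rmorphM; congr (_ * _).
    have -> : (p %% q == 1)%N = (p%:R == 1 :> 'F_q).
      have valE k : val (k%:R : 'F_q) = (k %% q)%N := val_Fp_nat q_pr k.
      rewrite -[1]/(1%:R : 'F_q) -(inj_eq val_inj) !valE.
      by rewrite [(1 %% q)%N]modn_small // ltnW.
    by case: eqP => _; rewrite ?mulr1 ?mulr0 ?rmorph_nat.
  apply: (le_trans (normc_sum _ _ _)); apply: ler_sum => j _.
  exact: (haC j).2.
have T_ge0 N : 0 <= T N.
  by apply: sumr_ge0 => p _; rewrite mulr_ge0 // divr_ge0 ?ln_nat_ge0.
(* If [A <= -1], then [m T N + ln N <= C] for all [N > 0], against [T N >= 0] and the growth of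
   [ln N]. *)
have A0 : 0 <= A.
  rewrite leNgt; apply/negP => A0.
  have [N N0 CN] := ln_unbounded C.
  have := T_bound N N0; rewrite ler_norml => /andP[_].
  have h1 : A%:~R <= -1 :> R by rewrite -(intrN R 1) ler_int; lia.
  have h2 := ln_nat_ge0 R N; have h3 : 0 <= m%:R * T N by rewrite mulr_ge0.
  by nra.
have m0' : 0 < m%:R :> R by rewrite ltr0n.
exists (A%:~R / m%:R).
  by rewrite divr_ge0 ?ler0z //= ler_pdivrMr // mulVf ?gt_eqF // -[1]/(1%:~R) ler_int.
exists ((C + A%:~R * K) / m%:R) => N N0.
rewrite ler_pdivlMr // -[X in _ * X <= _](gtr0_norm m0') -normrM mulrC.
set P := \sum_(1 <= p < N.+1 | prime p) ln p / p%:R.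
have -> : m%:R * \sum_(1 <= p < N.+1 | prime p)
      ((p %% q == 1)%N%:R - A%:~R / m%:R) * (ln p / p%:R) =
    m%:R * T N - A%:~R * ln N - A%:~R * (P - ln N).
  under eq_bigr do rewrite mulrBl.
  rewrite sumrB mulrBr -/(T N) -mulr_sumr -/P [X in _ - X]mulrCA -mulrA [m%:R^-1 * _]mulKf ?gt_eqF //.
  by ring.
apply: (le_trans (ler_normB _ _)); apply: lerD; first exact: T_bound.
rewrite normrM ger0_norm ?ler0z // ler_wpM2l ?ler0z //; exact: hK.
Qed.

End PrimesModPrime.

(** * Dirichlet density *)

Section DirichletDensity.
Local Open Scope classical_set_scope.
Local Open Scope ring_scope.
Variables (R : realType).
Local Notation ln n := (@exp.ln R n%:R).
Implicit Types (B : pred nat) (s c C : R).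

(** The integral comparison by telescoping: [n^(-s)] is at most the decrease of [n^(1-s) / (s - 1)]
    from [n - 1] to [n], by [exp x >= 1 + x] and [ln n - ln (n - 1) >= 1 / n]. *)
Lemma sum_powR_bound s N : 1 < s ->
  \sum_(1 <= n < N.+1) n%:R `^ (- s) <= 1 + (s - 1)^-1.
Proof.
move=> s1; have s10 : 0 < s - 1 by rewrite subr_gt0.
case: N => [|N]; first by rewrite big_geq // addr_ge0 // invr_ge0 ltW.
suff : \sum_(1 <= n < N.+2) n%:R `^ (- s) <= 1 + (s - 1)^-1 * (1 - N.+1%:R `^ (1 - s)).
  move/le_trans; apply; rewrite lerD2l; apply: ler_piMr; first by rewrite invr_ge0 ltW.
  by rewrite gerBl powR_ge0.
elim: N => [|N IH].
  by rewrite big_nat1 powR1 /= subrr mulr0 addr0.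
rewrite big_nat_recr //=.
suff : N.+2%:R `^ (- s) <= (s - 1)^-1 * (N.+1%:R `^ (1 - s) - N.+2%:R `^ (1 - s)) :> R.
  by move=> h; apply: le_trans (lerD IH h) _; rewrite -addrA -mulrDr addrA subrK.
rewrite ler_pdivlMl //.
have n0 : 0 < N.+2%:R :> R by rewrite ltr0n.
have n1 : 0 < N.+1%:R :> R by rewrite ltr0n.
have E : N.+1%:R `^ (1 - s) = N.+2%:R `^ (1 - s) * expR ((s - 1) * (ln N.+2 - ln N.+1)) :> R.
  by rewrite /powR !gt_eqF // -expRD; congr expR; ring.
have E2 : N.+2%:R `^ (1 - s) = N.+2%:R * N.+2%:R `^ (- s) :> R.
  by rewrite powRD ?powRr1 ?ltW // (gt_eqF n0) implybT.
rewrite E -[X in _ <= _ - X]mulr1 -mulrBr.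
have h1 := expR_ge1Dx ((s - 1) * (ln N.+2 - ln N.+1)).
have h2 : N.+2%:R^-1 <= ln N.+2 - ln N.+1.
  have := @le_ln1Dx R (- N.+2%:R^-1).
  rewrite ltrN2 invf_lt1 // ltr1n => /(_ isT).
  have -> : 1 + - N.+2%:R^-1 = N.+1%:R / N.+2%:R :> R.
    by rewrite -[N.+2%:R]natr1 in n0 *; field; rewrite gt_eqF.
  by rewrite ln_div ?posrE // -opprB lerN2.
apply: (@le_trans _ _ (N.+2%:R `^ (1 - s) * ((s - 1) * N.+2%:R^-1))).
  rewrite E2 le_eqVlt; apply/orP; left; apply/eqP.
  move: n0; move: (N.+2%:R : R) (N.+2%:R `^ (- s)) => x y x0.
  by field; rewrite gt_eqF.
rewrite ler_wpM2l ?powR_ge0 //.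
have : (s - 1) * N.+2%:R^-1 <= (s - 1) * (ln N.+2 - ln N.+1) by rewrite ler_wpM2l // ltW.
by move=> h3; rewrite lerBrDl (le_trans _ h1) // lerD2l.
Qed.

(** The partial sums are monotone and bounded by [sum_powR_bound], so the extended sum is finite and
    [fine] keeps its value. *)
Lemma prime_zeta_cvg B s : 1 < s ->
  \sum_(0 <= n < N | prime n && B n) n%:R `^ (- s) @[N --> \oo] -->
  prime_zeta [set p | prime p && B p] s.
Proof.
move=> s1; pose u N : R := \sum_(0 <= n < N | prime n && B n) n%:R `^ (- s).
have u_nd : {homo u : m n / (m <= n)%N >-> m <= n}.
  move=> m n mn; rewrite /u [leRHS](@big_cat_nat _ _ _ m) //= lerDl.
  by apply: sumr_ge0 => i _; exact: powR_ge0.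
have u_ub N : u N <= 1 + (s - 1)^-1.
  apply: (le_trans (u_nd _ _ (leqnSn N))); apply: le_trans (sum_powR_bound N s1).
  rewrite /u big_ltn_cond //= big_mkcond.
  by apply: ler_sum => i _; case: ifP => // _; exact: powR_ge0.
have u_cvg : cvgn u.
  apply: nondecreasing_is_cvgn; first exact: u_nd.
  by exists (1 + (s - 1)^-1) => _ [N _ <-].
suff -> : prime_zeta [set p | prime p && B p] s = limn u by [].
rewrite /prime_zeta -nneseries_esum; last by move=> n _; rewrite lee_fin powR_ge0.
have -> : (fun n => \sum_(0 <= i < n | prime i && B i) (i%:R `^ (- s))%:E)%E = EFin \o u.
  by apply/funext => n /=; rewrite sumEFin.
by rewrite EFin_lim.
Qed.

Lemma sum_inv_primes_unbounded (A : R) :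
  exists N, A <= \sum_(1 <= p < N.+1 | prime p) p%:R^-1.
Proof.
have [K hK] := mertens_primes R.
pose S N : R := \sum_(1 <= p < N.+1 | prime p) p%:R^-1.
suff H k : exists N, k%:R / 4 <= S N.
  have [N hN] := H (Num.bound (`|A| * 4)); exists N; apply: le_trans hN.
  rewrite ler_pdivlMr // ltW // (le_lt_trans _ (archi_boundP _)) //.
  by rewrite ler_wpM2r // ler_norm.
elim: k => [|k [N0 IH]]; first by exists 0%N; rewrite mul0r /S big_geq.
(* Between [M] and [M * M], the sum of [ln p / p] grows by at least [ln M - 2 K] while
   [ln p <= 2 ln M]; with [ln M > 4 |K|] the sum of [1 / p] gains at least 1/4. *)
have [M1 M1_gt0 hM1] := @ln_unbounded R (4 * `|K| + 1).
pose M := maxn N0 M1; have M0 : (0 < M)%N by rewrite leq_max M1_gt0 orbT.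
have lnM : 4 * `|K| + 1 < ln M by rewrite (lt_le_trans hM1) // ler_ln_nat // leq_maxr.
have MM : (M <= M * M)%N by rewrite leq_pmulr.
have MM0 : (0 < M * M)%N by rewrite muln_gt0 M0.
exists (M * M)%N.
have E : S (M * M)%N = S M + \sum_(M.+1 <= p < (M * M).+1 | prime p) p%:R^-1.
  by rewrite /S (@big_cat_nat _ _ _ M.+1).
have S_le : S N0 <= S M.
  rewrite /S [leRHS](@big_cat_nat _ _ _ N0.+1) ?ltnS ?leq_maxl //= lerDl.
  exact: sumr_ge0.
rewrite E -natr1 mulrDl; apply: lerD; first exact: le_trans S_le.
have := hK _ M0; have := hK _ MM0; rewrite ln_natM //.
rewrite (@big_cat_nat _ _ _ M.+1) //=.
have : \sum_(M.+1 <= p < (M * M).+1 | prime p) ln p / p%:R <=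
    2 * ln M * \sum_(M.+1 <= p < (M * M).+1 | prime p) p%:R^-1.
  rewrite mulr_sumr big_nat_cond [leRHS]big_nat_cond.
  apply: ler_sum => p /andP[/andP[_ pM] _]; rewrite ler_wpM2r ?invr_ge0 //.
  by rewrite mulr_natl mulr2n -ln_natM // ler_ln_nat.
set T := \sum_(1 <= p < _ | _) _; set U := \sum_(_ <= p < _ | _) _ / _.
set V := \sum_(_ <= p < _ | _) _^-1 => hUV.
rewrite !ler_norml => /andP[h1 h2] /andP[h3 h4].
have h5 := ler_norm K; have h6 := normr_ge0 K.
have h7 : ln M / 2 <= 2 * ln M * V by lra.
rewrite -(@ler_pM2l _ (2 * ln M)); last by lra.
by lra.
Qed.

Lemma prime_zeta_ge s N : 1 < s ->
  \sum_(0 <= p < N | prime p) p%:R `^ (- s) <= prime_zeta [set p | prime p] s.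
Proof.
move=> s1; have := @prime_zeta_cvg xpredT s s1.
have -> : [set p | prime p && true] = [set p | prime p].
  by apply/seteqP; split => p /=; rewrite andbT.
under eq_fun do under eq_bigl do rewrite andbT.
move=> H; rewrite -(cvg_lim _ H) //; apply: nondecreasing_cvgn_le; last first.
  by apply/cvg_ex; eexists; exact: H.
move=> m n mn; rewrite [leRHS](@big_cat_nat _ _ _ m) //= lerDl.
by apply: sumr_ge0 => i _; exact: powR_ge0.
Qed.

Lemma prime_zeta_near1 (A : R) :
  \forall s \near 1^'+, A <= prime_zeta [set p | prime p] s.
Proof.
have [N hN] := sum_inv_primes_unbounded (2 * `|A|).
(* For [s < 1 + d] every [p <= N] has [p^(1-s) >= 1/2], which explains the factor 2 in [hN]. The
   added 1 keeps the denominator positive. *)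
pose d : R := ln 2 / (1 + ln N).
have ln2 : 0 < ln 2 by rewrite ln_gt0 // ltr1n.
have lnN : 0 < 1 + ln N by rewrite ltr_pwDl // ln_nat_ge0.
have d0 : 0 < d by rewrite divr_gt0.
near=> s.
have s1 : 1 < s by near: s; exact: nbhs_right_gt.
have sd : s < 1 + d by near: s; apply: nbhs_right_lt; rewrite ltrDl.
apply: le_trans (prime_zeta_ge N.+1 s1).
apply: (@le_trans _ _ ((\sum_(1 <= p < N.+1 | prime p) p%:R^-1) / 2)).
  by rewrite ler_pdivlMr // mulrC; apply: le_trans hN; rewrite ler_wpM2l // ler_norm.
rewrite mulr_suml [leRHS]big_ltn_cond //= big_nat_cond [leRHS]big_nat_cond.
apply: ler_sum => p /andP[/andP[p0 pN] _].
have p0' : 0 < p%:R :> R by rewrite ltr0n.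
have -> : p%:R `^ (- s) = p%:R^-1 * p%:R `^ (1 - s).
  rewrite [in LHS](_ : - s = - 1 + (1 - s)); last by ring.
  rewrite powRD; last by rewrite (gt_eqF p0') implybT.
  by rewrite powR_inv1 ?ltW.
rewrite ler_wpM2l ?invr_ge0 //.
rewrite /powR gt_eqF //; have -> : 2^-1 = expR (- ln 2) :> R by rewrite expRN lnK ?posrE.
rewrite ler_expR.
have h1 : ln p <= ln N by exact: ler_ln_nat.
have h2 : (s - 1) * (1 + ln N) <= ln 2.
  by rewrite -ler_pdivlMr // -/d; lra.
have h3 := ln_nat_ge0 R p.
by nra.
Unshelve. all: by end_near.
Qed.

(** The difference of the zeta sum of [B] and [c] times the full one stays bounded uniformly in
    [s > 1], while the full sum tends to infinity as [s] tends to 1. *)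
Lemma dirichlet_density_mertens B c C :
    (forall N, (0 < N)%N ->
      `|\sum_(1 <= p < N.+1 | prime p) ((B p)%:R - c) * (ln p / p%:R)| <= C) ->
  has_dirichlet_density [set p | prime p && B p] c.
Proof.
move=> HC.
have C0 : 0 <= C by apply: le_trans (HC 1%N isT).
have ln2 : 0 < ln 2 by rewrite ln_gt0 // ltr1n.
have zeta_diff s : 1 < s ->
  `|prime_zeta [set p | prime p && B p] s - c * prime_zeta [set p | prime p] s| <= C / ln 2.
  move=> s1; have HB := @prime_zeta_cvg B s s1; have HT := @prime_zeta_cvg xpredT s s1.
  have ET : [set p | prime p && true] = [set p | prime p].
    by apply/seteqP; split => p /=; rewrite andbT.
  rewrite ET in HT.
  have H : `|\sum_(0 <= n < N | prime n && B n) n%:R `^ (- s) -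
      c * \sum_(0 <= n < N | prime n && true) n%:R `^ (- s)| @[N --> \oo] -->
    `|prime_zeta [set p | prime p && B p] s - c * prime_zeta [set p | prime p] s|.
    by apply: cvg_norm; apply: cvgB HB _; apply: cvgM HT; exact: cvg_cst.
  pose a n : R := if prime n then ((B n)%:R - c) * (ln n / n%:R) else 0.
  pose w n : R := n%:R `^ (1 - s) / ln n.
  have a_bound N : `|\sum_(2 <= n < N) a n| <= C.
    case: N => [|[|N]]; [by rewrite big_geq // normr0..|].
    by have := HC N.+1 isT; rewrite big_mkcond big_ltn //= add0r => h; exact: h.
  have w_dec n : (2 <= n)%N -> 0 <= w n.+1 <= w n.
    move=> n2; have n0 : 0 < n%:R :> R by rewrite ltr0n; lia.
    have l0 : 0 < ln n by rewrite ln_gt0 // ltr1n.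
    have l1 : ln n <= ln n.+1 by exact: ler_ln_nat.
    rewrite /w divr_ge0 ?powR_ge0 ?ln_nat_ge0 //=.
    apply: ler_pM; rewrite ?powR_ge0 ?invr_ge0 ?ln_nat_ge0 //; last first.
      by rewrite lef_pV2 // posrE (lt_le_trans l0).
    rewrite -(opprB s 1) !(powRN _ (s - 1)) lef_pV2 ?posrE ?powR_gt0 //.
    by apply: ge0_ler_powR; rewrite ?nnegrE ?ler0n ?ler_nat //; lra.
  have part N : `|\sum_(0 <= n < N | prime n && B n) n%:R `^ (- s) -
      c * \sum_(0 <= n < N | prime n && true) n%:R `^ (- s)| <= C / ln 2.
    have -> : \sum_(0 <= n < N | prime n && B n) n%:R `^ (- s) -
      c * \sum_(0 <= n < N | prime n && true) n%:R `^ (- s) =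
      \sum_(2 <= n < N) a n * w n.
      rewrite mulr_sumr big_mkcond [X in _ - X]big_mkcond -sumrB.
      have big2 (F : nat -> R) : F 0%N = 0 -> F 1%N = 0 ->
          \sum_(0 <= n < N) F n = \sum_(2 <= n < N) F n.
        move=> F0 F1; case: N => [|[|N]]; first by rewrite !big_geq.
          by rewrite big_nat1 big_geq.
        by rewrite big_ltn // F0 add0r big_ltn // F1 add0r.
      rewrite big2 /= ?subrr //; apply: eq_big_nat => n /andP[n2 _].
      rewrite /a; case: (boolP (prime n)) => pn /=; last by rewrite subrr mul0r.
      have n0 : 0 < n%:R :> R by rewrite ltr0n; lia.
      have l0 : 0 < ln n by rewrite ln_gt0 // ltr1n.
      have -> : n%:R `^ (- s) = ln n / n%:R * w n.
        rewrite /w powRD ?powRr1 ?ltW //; last by rewrite (gt_eqF n0) implybT.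
        by field; rewrite !gt_eqF.
      by case: (B n) => /=; ring.
    apply: (le_trans (abel_bound N a_bound w_dec)).
    rewrite ler_wpM2l // /w ler_piMl ?invr_ge0 ?(ltW ln2) //.
    rewrite -[leRHS](powRr0 2); apply: ler_powR; first by rewrite ler1n.
    by lra.
  by apply: (cvgr_to_le H); apply: nearW => N; exact: part.
apply/cvgrPdist_le => e e0.
have zeta_big := prime_zeta_near1 (C / ln 2 / e + 1).
near=> s.
have s1 : 1 < s by near: s; exact: nbhs_right_gt.
have hZ : C / ln 2 / e + 1 <= prime_zeta [set p | prime p] s by near: s.
have := zeta_diff s s1; move: hZ; set Z := prime_zeta [set p | prime p] s.
set ZB := prime_zeta _ s => hZ hD.
have D0 : 0 <= C / ln 2 / e by rewrite !divr_ge0 // ltW.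
have Z0 : 0 < Z by lra.
rewrite distrC -[c](mulfK (lt0r_neq0 Z0)) -mulrBl normrM normfV (gtr0_norm Z0).
rewrite ler_pdivrMr //; apply: le_trans hD _.
by rewrite [leRHS]mulrC -ler_pdivrMr //; lra.
Unshelve. all: by end_near.
Qed.

End DirichletDensity.

(** * Inverses of cyclotomic values in a prime field *)

(** For prime [q], the value at [y] of the [q]-th cyclotomic polynomial. *)
Definition geom_sum (R : pzRingType) (q : nat) (y : R) : R := \sum_(i < q) y ^+ i.

Lemma geom_sum_morph (R S : pzRingType) (h : {rmorphism R -> S}) q y :
  h (geom_sum q y) = geom_sum q (h y).
Proof. by rewrite rmorph_sum; apply: eq_bigr => i _; rewrite rmorphXn. Qed.

Lemma geom_sum0 (R : pzRingType) q : (0 < q)%N -> geom_sum q (0 : R) = 1.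
Proof.
case: q => // q _; rewrite /geom_sum big_ord_recl expr0 big1 ?addr0 // => i _.
by rewrite expr0n.
Qed.

Section PrimeField.
Variables (p q : nat).
Hypotheses (p_pr : prime p) (q_pr : prime q) (qp : (q < p)%N) (pq1 : (p %% q != 1)%N).

(** A zero satisfies [y^q = 1] and [y^(p-1) = 1]; these exponents are coprime, so [y = 1]. But then
    the value is [q], nonzero modulo [p]. *)
Lemma geom_sum_neq0 (y : 'F_p) : geom_sum q y != 0.
Proof.
apply/eqP => fy0; have q1 := prime_gt1 q_pr.
have yq : y ^+ q = 1 by apply/eqP; rewrite -subr_eq0 subrX1 -/(geom_sum q y) fy0 mulr0.
have y0 : y != 0 by apply: contra_eqN yq => /eqP->; rewrite expr0n gtn_eqF ?(ltnW q1) // eq_sym oner_eq0.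
have yp : y ^+ p.-1 = 1.
  apply: (mulfI y0); rewrite mulr1 -exprS prednK ?prime_gt0 //.
  by rewrite -[X in _ ^+ X](card_Fp p_pr) expf_card.
have cop : coprime q p.-1.
  rewrite prime_coprime //; apply: contra pq1 => /dvdnP[k pk].
  by rewrite -(prednK (prime_gt0 p_pr)) pk -addn1 modnMDl modn_small.
have y1 : y = 1.
  case: (egcdnP p.-1 (prime_gt0 q_pr)) => u v uv _; rewrite (eqP cop) in uv.
  have : y ^+ (u * q) = y ^+ (v * p.-1 + 1) by rewrite uv.
  by rewrite exprD mulnC exprM yq expr1n mulnC exprM yp expr1n mul1r expr1 => ->.
have /eqP : (q%:R : 'F_p) = 0.
  rewrite -fy0 /geom_sum y1; under eq_bigr do rewrite expr1n.
  by rewrite sumr_const card_ord.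
rewrite -(dvdn_pcharf (pchar_Fp p_pr)) dvdn_prime2 // => /eqP pq.
by move: qp; rewrite pq ltnn.
Qed.

Definition inv_geom_values : {set 'F_p} := [set (geom_sum q y)^-1 | y : 'F_p].

(** The fibre over [a] consists of roots of [f - 1 / a], a polynomial of degree [q - 1]. *)
Lemma card_inv_geom_values : (p <= #|inv_geom_values| * q.-1)%N.
Proof.
rewrite -{1}(card_Fp p_pr) -[leqLHS]sum1_card.
rewrite (partition_big (fun y => (geom_sum q y)^-1) (mem inv_geom_values)) /=; last first.
  by move=> y _; apply/imsetP; exists y.
rewrite -sum_nat_const; apply: leq_sum => a _; rewrite sum1_card.
pose P : {poly 'F_p} := \poly_(i < q) 1 - (a^-1)%:P.
have q1 := prime_gt1 q_pr.
have szP : size P = q.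
  have sz1 : size (\poly_(i < q) (1 : 'F_p)) = q by rewrite size_poly_eq ?oner_eq0.
  by rewrite size_polyDl sz1 // size_polyN (leq_ltn_trans (size_polyC_leq1 _)).
have P0 : P != 0 by rewrite -size_poly_eq0 szP gtn_eqF // ltnW.
rewrite cardE -ltnS (prednK (prime_gt0 q_pr)) -[X in (_ < X)%N]szP.
apply: max_poly_roots => //; last exact: enum_uniq.
apply/allP => y; rewrite mem_enum => ya; have {}ya : (geom_sum q y)^-1 = a by exact/eqP.
rewrite /root /P !hornerE horner_poly -ya invrK subr_eq0; apply/eqP.
by apply: eq_bigr => i _; rewrite mul1r.
Qed.

End PrimeField.

(** * Sums of differences in a prime field *)

Section Sumset.
Variables (p : nat) (A : {set 'F_p}).
Hypotheses (p_pr : prime p) (A1 : (1 < #|A|)%N).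

Fixpoint diff_sums k : {set 'F_p} :=
  if k is k'.+1 then [set x + (d.1 - d.2) | x in diff_sums k', d in finset.setX A A]
  else [set 0].

Lemma diff_sumsP k x : x \in diff_sums k -> exists a b : nat -> 'F_p,
  (forall i, (i < k)%N -> a i \in A /\ b i \in A) /\ x = \sum_(i < k) (a i - b i).
Proof.
elim: k x => [|k IH] x.
  by rewrite inE => /eqP->; exists (fun=> 0), (fun=> 0); split => //; rewrite big_ord0.
case/imset2P => y [c d] /IH[a [b [ab ->]]]; rewrite inE /= => /andP[cA dA] ->.
exists (fun i => if i == k then c else a i), (fun i => if i == k then d else b i).
split=> [i|]; first by rewrite ltnS leq_eqVlt; case: eqP => //= _ /ab.
rewrite big_ord_recr /= eqxx; congr (_ + _); apply: eq_bigr => i _.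
by rewrite ltn_eqF.
Qed.

Let A_mem : exists a, a \in A.
Proof. by apply/finset.set0Pn; rewrite -card_gt0 ltnW. Qed.

Lemma diff_sumsS k : diff_sums k \subset diff_sums k.+1.
Proof.
have [a aA] := A_mem; apply/fintype.subsetP => x xk; apply/imset2P.
by exists x (a, a); rewrite ?inE ?aA //= subrr addr0.
Qed.

(** A stable set is closed under adding [a - b] for distinct [a], [b] in [A]; it contains 0, hence
    all multiples of a nonzero element of ['F_p]. *)
Lemma diff_sums_stable k : diff_sums k.+1 \subset diff_sums k -> diff_sums k = finset.setT.
Proof.
move=> /fintype.subsetP stab; have /card_gt1P[a [b [aA bA ab]]] := A1.
have d0 : a - b != 0 by rewrite subr_eq0.
have mul n : (a - b) *+ n \in diff_sums k.
  elim: n => [|n IH]; first by elim: k {stab} => [|k IHk]; rewrite ?inE // (fintype.subsetP (diff_sumsS _)).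
  by apply: stab; rewrite mulrSr; apply/imset2P; exists ((a - b) *+ n) (a, b); rewrite ?inE ?aA.
apply/finset.setP => x; rewrite inE -(divfK d0 x) -[x / _]natr_Zp mulr_natl; exact: mul.
Qed.

Let translates k : {set 'F_p} := [set x + a | x in diff_sums k, a in A].

(* A point [x] of [D_(k+2)] outside [D_(k+1) = D_k + A - A] gives a translate
   [x + A] disjoint from [D_k + A]. *)
Lemma card_translates k : diff_sums k.*2 = finset.setT \/ (k.+1 * #|A| <= #|translates k.*2|)%N.
Proof.
elim: k => [|k [IH|IH]].
- right; rewrite mul1n; apply: subset_leq_card; apply/fintype.subsetP => a aA.
  by apply/imset2P; exists 0 a; rewrite ?inE ?add0r.
- left; apply/eqP; rewrite -finset.subTset -IH doubleS.
  exact: fintype.subset_trans (diff_sumsS _) (diff_sumsS _).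
have [/diff_sums_stable E|] := boolP (diff_sums k.*2.+2 \subset diff_sums k.*2.+1).
  left; apply/eqP; rewrite -finset.subTset -E doubleS; exact: diff_sumsS.
case/fintype.subsetPn => x x2 x1; right.
have -> : (k.+2 * #|A| = k.+1 * #|A| + #|[set (x + a)%R | a in A]|)%N.
  by rewrite card_imset ?mulSn 1?addnC //; exact: addrI.
apply: (leq_trans (leq_add IH (leqnn _))).
rewrite -cardsUI [X in (_ + X)%N](_ : _ = 0%N) ?addn0; last first.
  apply/eqP; rewrite cards_eq0; apply/eqP/finset.setP => y; rewrite !inE.
  apply/negP => /andP[/imset2P[z a zk aA ->] /imsetP[b bA zx]].
  case/negP: x1; apply/imset2P; exists z (a, b); rewrite ?inE ?aA //=.
  by rewrite addrA zx addrK.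
apply: subset_leq_card; rewrite finset.subUset; apply/andP; split; apply/fintype.subsetP => y.
  case/imset2P => z a zk aA ->; apply/imset2P; exists z a => //.
  by rewrite doubleS (fintype.subsetP (diff_sumsS _)) // (fintype.subsetP (diff_sumsS _)).
by case/imsetP => a aA ->; apply/imset2P; exists x a.
Qed.

(** Otherwise [card_translates] gives [(k + 1) |A| <= p <= k |A|]. *)
Lemma diff_sums_cover k : (p <= #|A| * k)%N -> diff_sums k.*2 = finset.setT.
Proof.
move=> pk; case: (card_translates k) => // H.
have := leq_trans H (max_card _); rewrite card_Fp // => H2.
by have := leq_trans H2 pk; rewrite mulnC leq_pmul2l ?ltnn // ltnW.
Qed.

End Sumset.

(** * The existential formula *)

Section Formula.
Variables (q k : nat).

(** Horner's scheme. *)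
Definition geom_term n (t : rterm n) : rterm n :=
  iter q (fun s => TAdd (TOne n) (TMul t s)) (TZero n).

Definition sum_term n (I : finType) (t : I -> rterm n) : rterm n :=
  foldr (fun i => TAdd (t i)) (TZero n) (enum I).

Definition forall_formula n (I : finType) (psi : I -> qf_formula n) : qf_formula n :=
  foldr (fun i => FAnd (psi i)) (FEq (TZero n) (TZero n)) (enum I).

(* [exists y w z u, (forall j, w_j f(y_j) = 1) /\ (forall j, u_j f(z_j) = 1) /\
   x = sum_j w_j - sum_j u_j] with [f = 1 + X + ... + X^(q-1)]. *)
Definition val_ring_matrix : qf_formula ((k.+1 + k.+1) + (k + k)).+1 :=
  let Y j := TVar (lift ord0 (lshift (k + k) (lshift k.+1 j))) in
  let W j := TVar (lift ord0 (lshift (k + k) (rshift k.+1 j))) in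
  let Z j := TVar (lift ord0 (rshift (k.+1 + k.+1) (lshift k j))) in
  let U j := TVar (lift ord0 (rshift (k.+1 + k.+1) (rshift k j))) in
  FAnd (forall_formula (fun j => FEq (TMul (W j) (geom_term (Y j))) (TOne _)))
  (FAnd (forall_formula (fun j => FEq (TMul (U j) (geom_term (Z j))) (TOne _)))
        (FEq (TVar ord0) (TSub (sum_term W) (sum_term U)))).

Definition val_ring_formula : eformula := EFormula val_ring_matrix.

Variable K : nzRingType.

Lemma eval_geom_term n (v : 'I_n -> K) t :
  eval_term v (geom_term t) = geom_sum q (eval_term v t).
Proof.
rewrite /geom_term /geom_sum; elim: q => [|m IH]; first by rewrite big_ord0.
rewrite iterS /= IH big_ord_recl expr0; congr (_ + _).
by rewrite mulr_sumr; apply: eq_bigr => i _; rewrite exprS.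
Qed.

Lemma eval_sum_term n (v : 'I_n -> K) (I : finType) (t : I -> rterm n) :
  eval_term v (sum_term t) = \sum_i eval_term v (t i).
Proof.
rewrite /sum_term -big_enum /=; elim: (enum I) => [|i s IH]; first by rewrite big_nil.
by rewrite big_cons /= IH.
Qed.

Lemma holds_forall_formula n (v : 'I_n -> K) (I : finType) (psi : I -> qf_formula n) :
  holds_qf v (forall_formula psi) <-> forall i, holds_qf v (psi i).
Proof.
rewrite /forall_formula.
suff H s : holds_qf v (foldr (fun i => FAnd (psi i)) (FEq (TZero n) (TZero n)) s) <->
    forall i, i \in s -> holds_qf v (psi i).
  by rewrite H; split => h i; [apply: h; rewrite mem_enum|move=> _; exact: h].
elim: s => [|i s IH] //=; rewrite IH; split => [[hi hs] j|h].
  by rewrite inE => /predU1P[->|/hs].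
by split=> [|j js]; apply: h; rewrite inE ?eqxx ?js ?orbT.
Qed.

Lemma env_cons0 m (x : K) (e : 'I_m -> K) : env_cons x e ord0 = x.
Proof. by rewrite /env_cons unlift_none. Qed.

Lemma env_cons_lift m (x : K) (e : 'I_m -> K) i : env_cons x e (lift ord0 i) = e i.
Proof. by rewrite /env_cons liftK. Qed.

Lemma val_ring_formulaP (x : K) : defined_set val_ring_formula x <->
  exists (y w : 'I_k.+1 -> K) (z u : 'I_k -> K),
    [/\ forall j, w j * geom_sum q (y j) = 1, forall j, u j * geom_sum q (z j) = 1 &
        x = \sum_j w j - \sum_j u j].
Proof.
pose M := ((k.+1 + k.+1) + (k + k))%N.
have E (e : 'I_M -> K) : holds_qf (env_cons x e) val_ring_matrix <->
  [/\ forall j, e (lshift _ (rshift _ j)) * geom_sum q (e (lshift _ (lshift _ j))) = 1,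
      forall j, e (rshift _ (rshift _ j)) * geom_sum q (e (rshift _ (lshift _ j))) = 1 &
      x = \sum_(j < k.+1) e (lshift _ (rshift _ j)) - \sum_(j < k) e (rshift _ (rshift _ j))].
  rewrite /= !holds_forall_formula !eval_sum_term env_cons0 /=.
  under eq_bigr do rewrite env_cons_lift.
  under [\sum_(i < k) _]eq_bigr do rewrite env_cons_lift.
  split=> [[h1 [h2 h3]]|[h1 h2 h3]]; split => //.
  - by move=> j; have := h1 j; rewrite eval_geom_term /= !env_cons_lift.
  - by move=> j; have := h2 j; rewrite eval_geom_term /= !env_cons_lift.
  - by move=> j; rewrite eval_geom_term /= !env_cons_lift.
  - by split => // j; rewrite eval_geom_term /= !env_cons_lift.
split=> [[e /E[h1 h2 h3]]|[y [w [z [u [h1 h2 h3]]]]]].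
  by do 4 eexists; split; [exact: h1|exact: h2|exact: h3].
pose e (i : 'I_M) := match fintype.split i with
  | inl a => match fintype.split a with inl j => y j | inr j => w j end
  | inr a => match fintype.split a with inl j => z j | inr j => u j end end.
exists e; apply/E; rewrite /e.
have sl m n (j : 'I_m) : fintype.split (lshift n j) = inl j := unsplitK (inl j).
have sr m n (j : 'I_n) : fintype.split (rshift m j) = inr j := unsplitK (inr j).
split=> [j|j|]; rewrite ?sl ?sr ?sl //.
rewrite h3; congr (_ - _); apply: eq_bigr => j _; by rewrite ?sl ?sr ?sl.
Qed.

End Formula.

(** * Henselian valuation rings *)

Local Open Scope card_scope.
Local Open Scope quotient_scope.

(** Adding 1 permutes the [p] elements, so it leaves their sum unchanged. *)
Lemma natr_card_eq0 (F : comNzRingType) p (e : F -> 'I_p) : bijective e -> p%:R = 0 :> F.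
Proof.
case=> g eK gK; have s_inj : injective (fun i => e (g i + 1)).
  by move=> i j /(can_inj eK)/addIr/(can_inj gK).
have : \sum_(i < p) g i = \sum_(i < p) (g i + 1).
  by rewrite (reindex_inj s_inj); apply: eq_bigr => i _; rewrite eK.
rewrite big_split /= sumr_const card_ord -[LHS]addr0.
by move/addrI/esym.
Qed.

(** Since [p = 0] in [F], sending a residue to the corresponding multiple of 1 is a ring morphism.
    It is injective because ['F_p] is a field, then surjective by counting. *)
Lemma prime_card_iso (F : comNzRingType) p : prime p ->
  ([set: F]%classic #= `I_p)%classic ->
  exists2 h : {rmorphism 'F_p -> F}, injective h & forall x, exists y, h y = x.
Proof.
move=> p_pr /pcard_eqP[f].
have fp x : (f x < p)%N by have := @funS _ _ _ _ f x I.
pose e x := Ordinal (fp x).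
have e_inj : injective e.
  by move=> x y /(congr1 val) /= fxy; apply: (@inj _ _ _ f); rewrite ?inE.
have e_surj i : exists x, e x = i.
  have [x _ fx] := @surj _ _ _ _ f (val i) (ltn_ord i).
  by exists x; apply: val_inj.
have e_bij : bijective e.
  have [g eg] := choice e_surj; exists g => // x; exact/e_inj/eg.
have p0 := natr_card_eq0 e_bij.
pose h (x : 'F_p) : F := (x : nat)%:R.
have hE k : h k%:R = k%:R.
  by rewrite /h val_Fp_nat // [in RHS](divn_eq k p) natrD natrM p0 mulr0 add0r.
have hD : zmod_morphism h.
  move=> x y; have yp : (y <= p)%N.
    by rewrite ltnW // -[X in (_ < X)%N](Fp_cast p_pr) ltn_ord.
  have -> : x - y = (x + (p - y))%N%:R.
    by rewrite natrD natrB // pchar_Fp_0 // sub0r !natr_Zp.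
  by rewrite hE natrD natrB // p0 sub0r.
have hM : monoid_morphism h.
  split; first by rewrite -[1]/(1%:R : 'F_p) hE.
  by move=> x y; rewrite -[in LHS](natr_Zp x) -[in LHS](natr_Zp y) -natrM hE natrM.
pose h' : {rmorphism 'F_p -> F} := HB.pack h
  (GRing.isZmodMorphism.Build _ _ h hD) (GRing.isMonoidMorphism.Build _ _ h hM).
have h_inj : injective h' by exact: fmorph_inj.
exists h' => // x.
have /inj_card_bij[|g _ gK] : injective (fun y : 'F_p => e (h' y)).
- by move=> y z /e_inj/h_inj.
- by rewrite card_Fp // card_ord.
by exists (g (e x)); apply: e_inj; exact: gK.
Qed.

Section ResidueLift.
Variables (K : fieldType) (O : valuationRing K).
Let r : {rmorphism vring O -> residue_field O} := \pi_({ideal_quot (@max_ideal K O)}).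

Let toO x (xO : x \in vr_pred O) : vring O := exist (fun z => z \in vr_pred O) x xO.

Let v : {rmorphism vring O -> K} := \val.

Lemma residue_neq0_unit (a : vring O) : residue a != 0 -> exists b : vring O, a * b = 1.
Proof.
move=> a0; apply/max_idealPn; apply: contra a0 => aI.
rewrite -(rmorph0 r) /r /residue; apply/eqP.
by apply/eqP; rewrite -Quotient.idealrBE subr0.
Qed.

Lemma residue_surj (x : residue_field O) : exists a : vring O, residue a = x.
Proof. by elim/quotW: x => a; exists a. Qed.

Variables (p q : nat).
Hypotheses (p_pr : prime p) (q_pr : prime q) (qp : (q < p)%N) (pq1 : (p %% q != 1)%N).
Hypothesis cardF : ([set: residue_field O]%classic #= `I_p)%classic.

Lemma geom_sum_unit (a : vring O) : exists b : vring O, geom_sum q a * b = 1.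
Proof.
have [h h_inj h_surj] := prime_card_iso p_pr cardF.
apply: residue_neq0_unit; rewrite -[residue _]/(r _) geom_sum_morph.
have [y <-] := h_surj (r a); rewrite -geom_sum_morph -(rmorph0 h) (inj_eq h_inj).
exact: geom_sum_neq0.
Qed.

Lemma geom_sum_inv_mem (y w : K) : w * geom_sum q y = 1 -> w \in vr_pred O.
Proof.
have inO (a : vring O) u : u * geom_sum q (val a) = 1 -> exists2 b : vring O, u = val b & True.
  move=> ua; have [b ab] := geom_sum_unit a; exists b => //.
  have := congr1 v ab; rewrite rmorphM rmorph1 geom_sum_morph => ab'.
  by rewrite -[u]mulr1 -ab' mulrA ua mul1r.
have [yO|yO] := boolP (y \in vr_pred O).
  by move=> /(inO (toO yO))[b -> _]; exact: valP.
have y0 : y != 0.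
  by apply: contraNneq yO => ->; exact: (valP (0 : vring O)).
have [/(negP yO)//|yVO] := vr_total O y0.
pose c := toO yVO.
(* Palindromicity passes from [y] to the integral [y^-1]: the inverse of [geom_sum q y^-1] is an
   integral [b = w * y^(q-1)], whence [w = b * (y^-1)^(q-1)]. *)
have fE : geom_sum q y = y ^+ q.-1 * geom_sum q y^-1.
  rewrite /geom_sum mulr_sumr (reindex_inj rev_ord_inj); apply: eq_bigr => i _ /=.
  have -> : (q - i.+1 = q.-1 - i)%N by rewrite subnS predn_sub.
  have iq : (i <= q.-1)%N by rewrite -ltnS prednK ?prime_gt0.
  by rewrite -[in RHS](subnK iq) exprD exprVn mulfK // expf_neq0.
rewrite fE mulrA => /(inO c)[b wb _].
have -> : w = val (b * c ^+ q.-1).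
  by rewrite rmorphM rmorphXn /= -wb exprVn mulfK // expf_neq0.
exact: valP.
Qed.

Hypothesis hensO : henselian O.

(** The polynomial [f - 1 / t] reduces to [f - 1], which vanishes at 0 with derivative 1 because
    [q > 1]. *)
Lemma henselian_geom_sum (t : vring O) : residue t = 1 ->
  exists y : vring O, t * geom_sum q y = 1.
Proof.
move=> t1; have q1 := prime_gt1 q_pr.
have [|c tc] := @residue_neq0_unit t; first by rewrite t1 oner_neq0.
have c1 : residue c = 1.
  have /(congr1 r) := tc; rewrite rmorphM rmorph1 => <-.
  by rewrite -[r t]/(residue t) t1 mul1r.
pose g : {poly vring O} := \poly_(i < q) 1 - c%:P.
have gE : map_poly (@residue K O) g = \poly_(i < q) 1 - 1%:P.
  rewrite -[@residue K O]/(r : _ -> _) rmorphB /= map_polyC /= -[r c]/(residue c) c1.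
  congr (_ - _); apply/polyP => i; rewrite coef_map !coef_poly.
  by case: ifP => _; [exact: (rmorph1 r)|exact: (rmorph0 r)].
have [||y /rootP gy _] := hensO (f := g) (a := 0).
- rewrite gE /root hornerD hornerN hornerC horner_poly subr_eq0.
  apply/eqP; rewrite -[RHS](geom_sum0 (residue_field O) (ltnW q1)).
  by apply: eq_bigr => i _; rewrite mul1r.
- rewrite gE derivB derivC subr0 /root horner_coef0 coef_deriv coef_poly q1.
  by rewrite mulr1n oner_neq0.
exists y; rewrite -tc; congr (_ * _); apply/eqP; rewrite -subr_eq0 -gy /g.
rewrite hornerD hornerN hornerC horner_poly; apply/eqP; congr (_ - _).
by apply: eq_bigr => i _; rewrite mul1r.
Qed.

(** Each element of [inv_geom_values] lifts to an inverse value of [f] on the valuation ring, and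
    [diff_sums_cover] applies with [k = q - 1] by the count of these values. *)
Lemma residue_cover (x : residue_field O) :
  exists a b : 'I_(q.-1).*2 -> vring O,
  exists w u : 'I_(q.-1).*2 -> vring O,
  [/\ forall i, w i * geom_sum q (a i) = 1, forall i, u i * geom_sum q (b i) = 1 &
      x = residue (\sum_i w i - \sum_i u i)].
Proof.
have [h h_inj h_surj] := prime_card_iso p_pr cardF.
have lift (y : 'F_p) : y \in inv_geom_values p q -> exists aw : vring O * vring O,
    aw.2 * geom_sum q aw.1 = 1 /\ residue aw.2 = h y.
  case/imsetP => z _ ->; have [a az] := residue_surj (h z).
  have [b ab] := geom_sum_unit a; exists (a, b); split; first by rewrite mulrC.
  have f0 := geom_sum_neq0 p_pr q_pr qp pq1 z.
  have := congr1 r ab; rewrite rmorphM rmorph1 geom_sum_morph -[r a]/(residue a) az.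
  rewrite -geom_sum_morph => fb; rewrite -[LHS]mul1r -(rmorph1 h) -(mulVf f0).
  by rewrite rmorphM -mulrA fb mulr1.
have cardA := card_inv_geom_values p_pr q_pr.
(* A single value would force [p <= q - 1]. *)
have A1 : (1 < #|inv_geom_values p q|)%N.
  rewrite ltnNge; apply/negP => A1.
  have := leq_trans cardA (leq_mul A1 (leqnn _)); rewrite mul1n => h1.
  by have := leq_trans qp h1; have := prime_gt0 q_pr; lia.
have [y hy] := h_surj x.
have : y \in diff_sums (inv_geom_values p q) (q.-1).*2.
  by rewrite (diff_sums_cover p_pr A1 cardA) inE.
case/diff_sumsP => a [b [ab yE]].
have [aw haw] := choice (fun i : 'I_(q.-1).*2 => lift _ (ab i (ltn_ord i)).1).
have [bu hbu] := choice (fun i : 'I_(q.-1).*2 => lift _ (ab i (ltn_ord i)).2).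
exists (fun i => (aw i).1), (fun i => (bu i).1), (fun i => (aw i).2), (fun i => (bu i).2).
split=> [i|i|]; [exact: (haw i).1|exact: (hbu i).1|].
rewrite -hy yE -sumrB -[@residue K O]/(r : _ -> _) !rmorph_sum; apply: eq_bigr => i _.
by rewrite !rmorphB -[r (aw i).2]/(residue _) -[r (bu i).2]/(residue _) (haw i).2 (hbu i).2.
Qed.

Lemma val_ring_formula_defines :
  defined_set (val_ring_formula q (q.-1).*2) = [set x : K | x \in vr_pred O]%classic.
Proof.
apply/seteqP; split => x /=.
  case/val_ring_formulaP => y [w [z [u [hw hu ->]]]].
  pose w' j := toO (geom_sum_inv_mem (hw j)).
  pose u' j := toO (geom_sum_inv_mem (hu j)).
  have -> : \sum_j w j - \sum_j u j = v (\sum_j w' j - \sum_j u' j).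
    by rewrite rmorphB !rmorph_sum.
  exact: valP.
move=> xO; pose X := toO xO.
(* Covering [x - 1] rather than [x] leaves a remainder [t] of residue 1, which Hensel's lemma makes
   the extra inverse value; [W] places it at index 0. *)
have [a [b [w [u [hw hu hX]]]]] := residue_cover (residue X - 1).
pose t := X - (\sum_i w i - \sum_i u i).
have t1 : residue t = 1.
  by rewrite /t -[LHS]/(r _) rmorphB -[r (_ - _)]/(residue _) -hX opprB addrC subrK.
have [y hy] := henselian_geom_sum t1.
have up (c d : vring O) : c * geom_sum q d = 1 -> val c * geom_sum q (val d) = 1.
  by move/(congr1 v); rewrite rmorphM rmorph1 geom_sum_morph.
apply/val_ring_formulaP.
pose Y (i : 'I_(q.-1).*2.+1) := if unlift ord0 i is Some j then a j else y.
pose W (i : 'I_(q.-1).*2.+1) := if unlift ord0 i is Some j then w j else t.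
exists (val \o Y), (val \o W), (val \o b), (val \o u); split=> [j|j|].
- by apply: up; rewrite /Y /W; case: unliftP.
- exact: up.
rewrite -!(rmorph_sum v) -rmorphB -[x]/(v X); congr (v _).
rewrite big_ord_recl /W unlift_none; under eq_bigr do rewrite liftK.
by rewrite /t; ring.
Qed.

End ResidueLift.

(** * Choice of the formula and of the primes *)

Local Open Scope classical_set_scope.
Local Open Scope card_scope.
Local Open Scope ring_scope.

Theorem theorem1p2 (R : realType) (eps : R) (heps : 0 < eps) :
  exists (phi : eformula) (P : set nat),
    [/\ P `<=` [set p | prime p],
        exists2 d : R, has_dirichlet_density P d & 1 - eps <= d &
        forall (K : fieldType) (O : valuationRing K), henselian O ->
          (exists2 p : nat, P p & [set: residue_field O] #= `I_p) ->
          defined_set phi = [set x : K | x \in vr_pred O]].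
Proof.
have [q qN q_pr] := prime_above (maxn 2 (Num.bound eps^-1).+1).
have q2 : (2 < q)%N by apply: leq_ltn_trans qN; exact: leq_maxl.
have q_eps : (q.-1)%:R^-1 <= eps.
  have bq : (Num.bound eps^-1 < q.-1)%N.
    by rewrite -ltnS prednK ?prime_gt0 //; apply: leq_ltn_trans qN; exact: leq_maxr.
  rewrite -[leRHS]invrK lef_pV2 ?posrE ?invr_gt0 ?ltr0n //; last by lia.
  have eps0 : 0 <= eps^-1 by rewrite invr_ge0 ltW.
  by rewrite (le_trans (ltW (archi_boundP eps0))) // ler_nat ltnW.
pose B p := (q < p)%N && (p %% q != 1)%N.
exists (val_ring_formula q (q.-1).*2), [set p | prime p && B p]; split.
- by move=> p /= /andP[].
- have [c /andP[_ cq] [C hC]] := @mertens_primes_mod1 R q q_pr q2.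
  exists (1 - c); last by rewrite lerD2l lerN2 (le_trans cq).
  apply: (@dirichlet_density_mertens _ _ _
    (C + \sum_(1 <= p < q.+1) `|exp.ln p%:R / p%:R|)) => N N0.
  (* For [p > q], [B p] is the negation of [p = 1] modulo [q], so [s] is supported on [p <= q] and
     changes the Mertens sum by a bounded amount. *)
  pose s p : R := (B p)%:R - (1 - (p %% q == 1)%N%:R).
  have -> : \sum_(1 <= p < N.+1 | prime p) ((B p)%:R - (1 - c)) * (exp.ln p%:R / p%:R) =
      - (\sum_(1 <= p < N.+1 | prime p) ((p %% q == 1)%N%:R - c) * (exp.ln p%:R / p%:R)) +
      \sum_(1 <= p < N.+1 | prime p) s p * (exp.ln p%:R / p%:R).
    by rewrite -sumrN -big_split; apply: eq_bigr => p _ /=; rewrite /s; ring.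
  apply: (le_trans (ler_normD _ _)); rewrite normrN; apply: lerD; first exact: hC.
  apply: (le_trans (ler_norm_sum _ _ _)).
  have s_le p : `|s p * (exp.ln p%:R / p%:R)| <=
      if (p < q.+1)%N then `|exp.ln p%:R / p%:R| : R else 0.
    rewrite /s /B normrM ltnS; case: ltnP => _ /=.
      by case: eqP => _ /=; rewrite ?subrr ?subr0 ?subrr normr0 mul0r.
    rewrite ler_piMl // sub0r normrN.
    by case: eqP => _ /=; rewrite ?subrr ?subr0 ?normr0 ?normr1.
  apply: (@le_trans _ _ (\sum_(1 <= p < N.+1) `|s p * (exp.ln p%:R / p%:R)|)).
    by rewrite big_mkcond; apply: ler_sum => p _; case: ifP.
  (* Extending the range to [maxn N q] covers [N < q] too, so that the cut at [q] gives the same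
     constant for every [N]. *)
  apply: (@le_trans _ _ (\sum_(1 <= p < (maxn N q).+1)
      if (p < q.+1)%N then `|exp.ln p%:R / p%:R| : R else 0)).
    rewrite [leRHS](@big_cat_nat _ _ _ N.+1) ?ltnS ?leq_maxl //=.
    rewrite -[leLHS]addr0; apply: lerD; first exact: ler_sum.
    by apply: sumr_ge0 => p _; case: ifP.
  by rewrite -big_mkcond -(big_nat_widen _ _ _ xpredT) // ltnS leq_maxr.
- move=> K O hensO [p /= /andP[p_pr /andP[qp pq]] cardF].
  exact: val_ring_formula_defines cardF hensO.
Qed.
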